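(* Let $X\subset\mathbb{R}^d$ be compact and let $f\in\mathrm{PAff}(X;X)$ be a conformal piecewise affine map. Then $h_{\mathrm{top}}(f)\le\lambda^+(f)$.
   Context: **Piecewise affine maps.** A piecewise affine map $(X,\mathcal Z,f)$, written $f\in\mathrm{PAff}(X;X)$, consists of a compact set $X\subset\mathbb{R}^d$, a finite collection $\mathcal Z$ of open, pairwise disjoint polytopes such that $X'=\bigcup_{Z\in\mathcal Z}Z$ is dense in $X$, and a map $f:X'\to X$ such that $f_Z:=f|_Z:Z\to X$ is affine for each $Z\in\mathcal Z$. The $f_Z$ are the affine components of $f$; the linear part of $f_Z$ is $f_Z'$, and $d_xf:=f_Z'$ for $x\in Z$. $f$ is conformal if all its affine components are conformal, i.e. each $f_Z'$ is a nonzero scalar multiple of an orthogonal matrix. Put $U_n=\bigcap_{k=0}^{n-1}f^{-k}(X')$, the set of points where $f^n$ is defined; for $x\in U_n$, $d_xf^n$ is the corresponding product of linear parts along the orbit. **Topological entropy.** Let $d(\cdot,\cdot)$ be a metric defining the standard topology on $X$, $d_n^f(x,y)=\max_{0\le k<n}d(f^kx,f^ky)$, and let $S(d_n^f,\epsilon)$ be the minimal number of $d_n^f$-balls of radius $\epsilon$ needed to cover $U_n$. Then $h_{\mathrm{top}}(f)=\lim_{\epsilon\to0}\limsup_{n\to\infty}\frac1n\log S(d_n^f,\epsilon)$ (independent of the choice of metric). **Expansion rate.** $\lambda^+(f)=\limsup_{n\to\infty}\sup_{x\in U_n}\frac1n\max_{0\le k\le d}\log\|\Lambda^kd_xf^n\|$,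 where $\Lambda^k$ is the $k$-th exterior power (with $\|\Lambda^0\|=1$) and norms are induced by the Euclidean norm. *)

(* Defs.v *)
From HB Require Import structures.
From mathcomp Require Import all_boot all_order all_algebra.
From mathcomp Require Import all_classical all_reals all_analysis.

Set Implicit Arguments.
Unset Strict Implicit.
Unset Printing Implicit Defensive.

Import Order.TTheory GRing.Theory Num.Theory.
Import numFieldNormedType.Exports.

Local Open Scope classical_set_scope.
Local Open Scope ring_scope.

(* Points of R^d are column vectors 'cV[R]_d.  The
   library norm on 'cV[R]_d is the sup norm; it induces the standard topology
   and is used below only through topology and boundedness. *)

Section Euclidean.
Context {R : realType}.

Definition enorm {n} (x : 'cV[R]_n) : R := Num.sqrt (\sum_i x i 0 ^+ 2).

Definition opnorm {m n} (A : 'M[R]_(m, n)) : R :=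
  sup [set enorm (A *m x) | x in [set x : 'cV[R]_n | enorm x <= 1]].

Definition conformal_mx {d} (A : 'M[R]_d) : Prop :=
  exists (c : R) (Q : 'M[R]_d), [/\ c != 0, Q^T *m Q = 1%:M & A = c *: Q].

(* The strictly increasing I : {0..k-1} -> {0..d-1} index the basis vectors
   e_I = e_(I 0) /\ ... /\ e_(I (k-1)) of the k-th exterior power of R^d; this
   basis is orthonormal for the inner product induced by the Euclidean one. *)
Definition incr_index (k d : nat) : pred {ffun 'I_k -> 'I_d} :=
  [pred I : {ffun 'I_k -> 'I_d} |
    [forall i : 'I_k, forall j : 'I_k, (i < j)%N ==> (I i < I j)%N]].

(* The matrix of Lambda^k A in the basis (e_I): expanding
   A e_(J 0) /\ ... /\ A e_(J (k-1)) by multilinearity and antisymmetry, the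
   coefficient of e_I is the minor of A on the rows I and the columns J. *)
Definition ext_pow (k : nat) {d} (A : 'M[R]_d) :
    'M[R]_(#|@incr_index k d|, #|@incr_index k d|) :=
  \matrix_(i, j) \det (mxsub (enum_val i : {ffun 'I_k -> 'I_d})
                             (enum_val j : {ffun 'I_k -> 'I_d}) A).

End Euclidean.

Section PiecewiseAffine.
Context {R : realType} {d : nat}.
Local Notation V := 'cV[R]_d.

Definition open_polytope (Z : set V) : Prop :=
  bounded_set Z /\
  exists (m : nat) (a : 'I_m -> 'rV[R]_d) (b : 'I_m -> R),
    Z = [set x | forall i, (a i *m x) 0 0 < b i].

Definition affine_on (Z : set V) (f : V -> V) (A : 'M[R]_d) : Prop :=
  exists b : V, forall x, Z x -> f x = A *m x + b.

Definition regular_set (Zs : set (set V)) : set V := \bigcup_(Z in Zs) Z.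

(* The partial map f : X' -> X is given by a total function; its values outside
   X' = regular_set Zs are irrelevant to every notion below. *)
Record PAff (X : set V) (Zs : set (set V)) (f : V -> V) : Prop := {
  PAff_compact : compact X;
  PAff_finite : finite_set Zs;
  PAff_polytope : forall Z, Zs Z -> open_polytope Z;
  PAff_disjoint : trivIset Zs id;
  PAff_sub : regular_set Zs `<=` X;
  PAff_dense : X `<=` closure (regular_set Zs);
  PAff_maps : forall x, regular_set Zs x -> X (f x);
  PAff_affine : forall Z, Zs Z -> exists A, affine_on Z f A }.

(* The linear part of f on Z; it is unique when Z is open and nonempty. *)
Definition linear_part (f : V -> V) (Z : set V) : 'M[R]_d :=
  xget 0 [set A | affine_on Z f A].

(* The guard discards an empty member of Zs, whose linear part is arbitrary. *)
Definition conformal (Zs : set (set V)) (f : V -> V) : Prop :=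
  forall Z, Zs Z -> Z !=set0 -> conformal_mx (linear_part f Z).

(* The domain of the n-th iterate of the partial map f. *)
Definition iter_dom (Zs : set (set V)) (f : V -> V) (n : nat) : set V :=
  [set x | forall k, (k < n)%N -> regular_set Zs (iter k f x)].

Definition paff_diff (Zs : set (set V)) (f : V -> V) (x : V) : 'M[R]_d :=
  linear_part f (xget set0 [set Z | Zs Z /\ Z x]).

Fixpoint paff_diffn (Zs : set (set V)) (f : V -> V) (n : nat) (x : V) : 'M[R]_d :=
  if n is m.+1 then paff_diff Zs f (iter m f x) *m paff_diffn Zs f m x else 1%:M.

(* rho restricts to a metric on X that induces the standard topology of X. *)
Record std_metric (X : set V) (rho : V -> V -> R) : Prop := {
  std_metric_ge0 : forall x y, X x -> X y -> 0 <= rho x y;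
  std_metric_eq0 : forall x y, X x -> X y -> (rho x y = 0 <-> x = y);
  std_metric_sym : forall x y, X x -> X y -> rho x y = rho y x;
  std_metric_triangle : forall x y z, X x -> X y -> X z ->
    rho x z <= rho x y + rho y z;
  std_metric_nbhs : forall x, X x -> forall A : set V,
    within X (nbhs x) A <->
    exists2 e : R, 0 < e & forall y, X y -> rho x y < e -> A y }.

Definition dyn_dist (rho : V -> V -> R) (f : V -> V) (n : nat) (x y : V) : R :=
  \big[Num.max/0]_(k < n) rho (iter k f x) (iter k f y).

(* S(d_n^f, eps), with value +oo if there is no finite cover. *)
Definition cover_num (Zs : set (set V)) (f : V -> V) (rho : V -> V -> R)
    (n : nat) (eps : R) : \bar R :=
  ereal_inf [set (size s)%:R%:E | s in [set s : seq V |
    (forall c, c \in s -> iter_dom Zs f n c) /\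
    (forall x, iter_dom Zs f n x ->
       exists2 c, c \in s & dyn_dist rho f n c x < eps)]].

Definition htop (Zs : set (set V)) (f : V -> V) (rho : V -> V -> R) : \bar R :=
  lim (limn_esup (fun n => (n%:R^-1)%:E * lne (cover_num Zs f rho n eps))%E
         @[eps --> 0^'+]).

Definition expansion_rate (Zs : set (set V)) (f : V -> V) : \bar R :=
  limn_esup (fun n => ereal_sup
    [set ((n%:R^-1)%:E *
          \big[maxe/-oo]_(k < d.+1)
            lne (opnorm (ext_pow k (paff_diffn Zs f n x)))%:E)%E
    | x in iter_dom Zs f n]).

End PiecewiseAffine.

(* Main.v *)
(** Code points by their itineraries.  Fix [m] and let [r] be so small that a set
    of diameter [r] meets only [m]-cylinders whose closures share a point.  Cut a
    set of diameter [r] along these cylinders, map each piece forward by [f^m],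
    cut the image into [O(max(1, c)^d)] sets of diameter [r], where [c] is the
    conformal factor, and repeat.  Per block of [m] iterates the number of pieces
    grows by the factor [O(1) * mult_m * exp(m (lambda + delta))], where [mult_m]
    is the largest number of [m]-cylinders adherent to one point, so it remains to
    see that [mult_m] grows subexponentially.

    Cylinders adherent to a point become cones in its tangent space, on which the
    conformal linear parts act as isometries of the unit sphere.  The same
    cutting argument on the sphere, where no expansion occurs, bounds their growth
    rate by that of the number of [m]-cylinders adherent to a point and a
    direction at it.  Iterate over flags of orthonormal directions: the cone of a
    cylinder at a flag is invariant under translation along the flag, so at a
    complete flag there is only one. *)

Require Import Defs.
From mathcomp Require Import all_boot all_order all_algebra.
From mathcomp Require Import all_classical all_reals all_analysis.
From mathcomp Require Import ring lra.

Set Implicit Arguments.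
Unset Strict Implicit.
Unset Printing Implicit Defensive.

Import Order.TTheory GRing.Theory Num.Theory.
Import numFieldNormedType.Exports.

Local Open Scope classical_set_scope.
Local Open Scope ring_scope.

(** * Euclidean geometry of column vectors *)

Section Dot.
Context {R : realType}.
Implicit Types n : nat.

Definition dot n (x y : 'cV[R]_n) : R := (x^T *m y) 0 0.

Lemma dotE n (x y : 'cV[R]_n) : dot x y = \sum_i x i 0 * y i 0.
Proof. by rewrite /dot mxE; apply: eq_bigr => i _; rewrite mxE. Qed.

Lemma dotC n (x y : 'cV[R]_n) : dot x y = dot y x.
Proof. by rewrite !dotE; apply: eq_bigr => i _; rewrite mulrC. Qed.

Lemma dotDr n (x y z : 'cV[R]_n) : dot x (y + z) = dot x y + dot x z.
Proof. by rewrite /dot mulmxDr mxE. Qed.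

Lemma dotZr n a (x y : 'cV[R]_n) : dot x (a *: y) = a * dot x y.
Proof. by rewrite /dot -scalemxAr mxE. Qed.

Lemma dotNr n (x y : 'cV[R]_n) : dot x (- y) = - dot x y.
Proof. by rewrite -scaleN1r dotZr mulN1r. Qed.

Lemma dotBr n (x y z : 'cV[R]_n) : dot x (y - z) = dot x y - dot x z.
Proof. by rewrite dotDr dotNr. Qed.

Lemma dotDl n (x y z : 'cV[R]_n) : dot (y + z) x = dot y x + dot z x.
Proof. by rewrite ![dot _ x]dotC dotDr. Qed.

Lemma dotBl n (x y z : 'cV[R]_n) : dot (y - z) x = dot y x - dot z x.
Proof. by rewrite ![dot _ x]dotC dotBr. Qed.

Lemma dotZl n a (x y : 'cV[R]_n) : dot (a *: y) x = a * dot y x.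
Proof. by rewrite ![dot _ x]dotC dotZr. Qed.

Lemma dot0r n (x : 'cV[R]_n) : dot x 0 = 0.
Proof. by rewrite /dot mulmx0 mxE. Qed.

Lemma dot_mulmxr n (A : 'M[R]_n) (x y : 'cV[R]_n) :
  dot x (A *m y) = dot (A^T *m x) y.
Proof. by rewrite /dot trmx_mul trmxK mulmxA. Qed.

Lemma dot_ge0 n (x : 'cV[R]_n) : 0 <= dot x x.
Proof. by rewrite dotE sumr_ge0 // => i _; rewrite -expr2 sqr_ge0. Qed.

Lemma dot_eq0 n (x : 'cV[R]_n) : dot x x = 0 -> x = 0.
Proof.
rewrite dotE => /eqP; rewrite psumr_eq0; last first.
  by move=> i _; rewrite -expr2 sqr_ge0.
move=> /allP x0; apply/colP => i; rewrite mxE.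
by have /implyP/(_ isT) := x0 i (mem_index_enum i); rewrite mulf_eq0 orbb => /eqP.
Qed.

Lemma enormE n (x : 'cV[R]_n) : enorm x = Num.sqrt (dot x x).
Proof. by rewrite /enorm dotE; under eq_bigr do rewrite expr2. Qed.

Lemma enorm_ge0 n (x : 'cV[R]_n) : 0 <= enorm x.
Proof. exact: sqrtr_ge0. Qed.

Lemma enorm_sqr n (x : 'cV[R]_n) : enorm x ^+ 2 = dot x x.
Proof. by rewrite enormE sqr_sqrtr // dot_ge0. Qed.

Lemma enorm0 n : enorm (0 : 'cV[R]_n) = 0.
Proof. by rewrite enormE dot0r sqrtr0. Qed.

Lemma enorm_eq0 n (x : 'cV[R]_n) : enorm x = 0 -> x = 0.
Proof. by move=> x0; apply: dot_eq0; rewrite -enorm_sqr x0 expr0n. Qed.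

Lemma enormZ n a (x : 'cV[R]_n) : enorm (a *: x) = `|a| * enorm x.
Proof.
by rewrite !enormE dotZl dotZr mulrA -expr2 sqrtrM ?sqr_ge0 // sqrtr_sqr.
Qed.

Lemma enormN n (x : 'cV[R]_n) : enorm (- x) = enorm x.
Proof. by rewrite -scaleN1r enormZ normrN1 mul1r. Qed.

Lemma cauchy_schwarz n (x y : 'cV[R]_n) : dot x y <= enorm x * enorm y.
Proof.
have [y0|yn0] := eqVneq (dot y y) 0.
  by rewrite (dot_eq0 y0) dot0r enorm0 mulr0.
have yp : 0 < dot y y by rewrite lt_def yn0 dot_ge0.
have := dot_ge0 (dot y y *: x - dot x y *: y).
have -> : dot (dot y y *: x - dot x y *: y) (dot y y *: x - dot x y *: y) =
    dot y y * (dot x x * dot y y - dot x y ^+ 2).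
  rewrite !(dotBl, dotBr, dotZl, dotZr) (dotC y x); ring.
rewrite pmulr_rge0 // subr_ge0 => xy.
apply: le_trans (ler_norm _) _.
rewrite -(@ler_pXn2r _ 2%N) ?nnegrE ?mulr_ge0 ?enorm_ge0 //.
by rewrite exprMn !enorm_sqr real_normK ?num_real.
Qed.

Lemma ler_enormD n (x y : 'cV[R]_n) : enorm (x + y) <= enorm x + enorm y.
Proof.
rewrite -(@ler_pXn2r _ 2%N) ?nnegrE ?addr_ge0 ?enorm_ge0 //.
rewrite enorm_sqr !(dotDl, dotDr) (dotC y x) sqrrD !enorm_sqr.
have := cauchy_schwarz x y; lra.
Qed.

Lemma enorm_distC n (x y : 'cV[R]_n) : enorm (x - y) = enorm (y - x).
Proof. by rewrite -opprB enormN. Qed.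

Lemma enorm_triangle n (y x z : 'cV[R]_n) :
  enorm (x - z) <= enorm (x - y) + enorm (y - z).
Proof. by rewrite -[x - z](subrKA y); exact: ler_enormD. Qed.

Lemma norm_coord_enorm n (x : 'cV[R]_n) i : `|x i 0| <= enorm x.
Proof.
rewrite -(@ler_pXn2r _ 2%N) ?nnegrE ?enorm_ge0 //.
rewrite enorm_sqr dotE (bigD1 i) //= real_normK ?num_real // expr2 lerDl.
by rewrite sumr_ge0 // => j _; rewrite -expr2 sqr_ge0.
Qed.

(** The crude factor [n.+1] replaces the square root of [n]; it is positive even in dimension 0. *)
Lemma enorm_le_coord n (x : 'cV[R]_n) (a : R) : 0 <= a ->
  (forall i, `|x i 0| <= a) -> enorm x <= n.+1%:R * a.
Proof.
move=> a0 xa; rewrite -(@ler_pXn2r _ 2%N) ?nnegrE ?mulr_ge0 ?enorm_ge0 //.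
rewrite enorm_sqr dotE exprMn.
have le_a i : x i 0 * x i 0 <= a ^+ 2.
  by rewrite -expr2 -real_normK ?num_real // ler_pXn2r ?nnegrE // xa.
apply: le_trans (ler_sum _ (fun i _ => le_a i)) _.
rewrite sumr_const card_ord -[_ *+ n]mulr_natl ler_wpM2r ?sqr_ge0 //.
by rewrite -natrX ler_nat (leq_trans (leqnSn n)) // -mulnn leq_pmulr.
Qed.

Definition orthogonal_mx n (Q : 'M[R]_n) := Q^T *m Q = 1%:M.

Lemma dot_orthogonal n (Q : 'M[R]_n) (x y : 'cV[R]_n) : orthogonal_mx Q ->
  dot (Q *m x) (Q *m y) = dot x y.
Proof. by move=> QQ; rewrite dot_mulmxr mulmxA QQ mul1mx. Qed.

Lemma enorm_orthogonal n (Q : 'M[R]_n) (x : 'cV[R]_n) : orthogonal_mx Q ->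
  enorm (Q *m x) = enorm x.
Proof. by move=> QQ; rewrite !enormE dot_orthogonal. Qed.

Lemma orthogonal_mxM n (P Q : 'M[R]_n) :
  orthogonal_mx P -> orthogonal_mx Q -> orthogonal_mx (P *m Q).
Proof.
by move=> PP QQ; rewrite /orthogonal_mx trmx_mul mulmxA -(mulmxA Q^T) PP mulmx1.
Qed.

Lemma orthogonal_mx1 n : orthogonal_mx (1%:M : 'M[R]_n).
Proof. by rewrite /orthogonal_mx trmx1 mulmx1. Qed.

Lemma norm_det_orthogonal n (Q : 'M[R]_n) : orthogonal_mx Q -> `|\det Q| = 1.
Proof.
move=> QQ; have := det_mulmx Q^T Q; rewrite QQ det1 det_tr => /esym/eqP.
by rewrite -expr2 sqrf_eq1 => /orP[]/eqP->; rewrite ?normrN normr1.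
Qed.

End Dot.

(** * Orthonormal families and projections *)

Section Orthonormal.
Context {R : realType} {d : nat}.
Local Notation V := 'cV[R]_d.
Implicit Types (vs : seq V) (u v x y : V).

Fixpoint orthonormal_seq vs : Prop :=
  if vs is v :: vs' then
    [/\ dot v v = 1, forall u, u \in vs' -> dot v u = 0 & orthonormal_seq vs']
  else True.

Definition orthproj vs y : V := \sum_(u <- vs) dot u y *: u.

Lemma dot_proj vs u y : orthonormal_seq vs -> u \in vs ->
  dot u (orthproj vs y) = dot u y.
Proof.
rewrite /orthproj; elim: vs => [|v vs IH] //= [v1 v0 ON].
rewrite inE big_cons dotDr dotZr.
have [->|uv] /= := eqVneq u v => [_|uvs].
  suff -> : dot v (\sum_(w <- vs) dot w y *: w) = 0 by rewrite v1 mulr1 addr0.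
  rewrite big_seq; elim/big_rec: _ => [|w z wvs IHz]; first exact: dot0r.
  by rewrite dotDr dotZr IHz (v0 w) // mulr0 addr0.
by rewrite (dotC u v) (v0 u) // mulr0 add0r IH.
Qed.

Lemma dot_proj_eq0 vs u y : (forall v, v \in vs -> dot v u = 0) ->
  dot (orthproj vs y) u = 0.
Proof.
move=> u0; rewrite dotC /orthproj big_seq; elim/big_rec: _ => [|w z wvs IHz].
  exact: dot0r.
by rewrite dotDr dotZr IHz (dotC u w) u0 // mulr0 addr0.
Qed.

Lemma orthonormal_map (Q : 'M[R]_d) vs : orthogonal_mx Q ->
  orthonormal_seq vs -> orthonormal_seq (map (mulmx Q) vs).
Proof.
move=> QQ; elim: vs => //= v vs IH [v1 v0 /IH ON]; split=> //.
  by rewrite dot_orthogonal.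
by move=> _ /mapP[u uvs ->]; rewrite dot_orthogonal // v0.
Qed.

Lemma orthonormal_nth vs i j : orthonormal_seq vs ->
  (i < size vs)%N -> (j < size vs)%N ->
  dot (nth 0 vs i) (nth 0 vs j) = (i == j)%:R.
Proof.
elim: vs i j => //= v vs IH [|i] [|j] [v1 v0 ON] //= ilt jlt.
- by rewrite v0 // mem_nth.
- by rewrite dotC v0 // mem_nth.
- by rewrite IH.
Qed.

Let mxseq vs : 'M[R]_(size vs, d) := \matrix_(i, j) nth 0 vs i j 0.

Let mxseqE vs y (i : 'I_(size vs)) : (mxseq vs *m y) i 0 = dot (nth 0 vs i) y.
Proof. by rewrite dotE mxE; apply: eq_bigr => j _; rewrite mxE. Qed.

Lemma orthonormal_full vs y : orthonormal_seq vs -> size vs = d ->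
  (forall u, u \in vs -> dot u y = 0) -> y = 0.
Proof.
move=> ON sz y0.
have MM : mxseq vs *m (mxseq vs)^T = 1%:M.
  apply/matrixP => i j; rewrite [RHS]mxE -val_eqE.
  rewrite -(orthonormal_nth ON (ltn_ord i) (ltn_ord j)).
  by rewrite dotE mxE; apply: eq_bigr => k _; rewrite !mxE.
have My : mxseq vs *m y = 0.
  by apply/colP => i; rewrite mxseqE [RHS]mxE y0 // mem_nth.
(* The equality of sizes makes the matrix square, so its right inverse is also a left inverse. *)
move: (mxseq vs) MM My; rewrite sz => M /mulmx1C MM My.
by rewrite -[y]mul1mx -MM -mulmxA My mulmx0.
Qed.

(** The matrix with rows [vs] has rank at most [size vs], so in dimension [d] its kernel is
    nonzero. *)
Lemma orthonormal_ext vs : (size vs < d)%N ->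
  exists2 z : V, z != 0 & forall u, u \in vs -> dot u z = 0.
Proof.
move=> sz; pose K := kermx (mxseq vs)^T.
have : K != 0.
  rewrite -mxrank_eq0 mxrank_ker -lt0n subn_gt0.
  exact: leq_ltn_trans (rank_leq_col _) sz.
move=> /rowV0Pn[v vK v0]; exists v^T.
  by apply: contra v0 => /eqP v0; rewrite -[v]trmxK v0 trmx0.
move=> u /(nthP 0)[i ilt <-].
rewrite -(mxseqE _ (Ordinal ilt)) -[mxseq vs]trmxK -trmx_mul.
by move/sub_kermxP : vK => ->; rewrite !mxE.
Qed.

End Orthonormal.

(** * Lebesgue numbers *)

Section Compactness.
Context {R : realType} {d : nat}.
Local Notation V := 'cV[R]_d.
Implicit Types (K X : set V) (x y p q : V) (r e : R).

Lemma ball_enorm p r x : ball p (r / (d.+1)%:R) x -> enorm (x - p) <= r.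
Proof.
move=> [r0 px]; rewrite -[leRHS](divrK (_ : (d.+1)%:R \is a GRing.unit)) ?unitfE //.
rewrite mulrC; apply: enorm_le_coord => [|i]; first exact: ltW.
by have := px i 0; rewrite /ball /= => /ltW; rewrite !mxE distrC.
Qed.

Lemma enorm_ball p r x : enorm (x - p) < r -> ball p r x.
Proof.
move=> pxr; split; first exact: le_lt_trans (enorm_ge0 _) pxr.
move=> i j; rewrite (ord1 j) /ball /= distrC; apply: le_lt_trans pxr.
by have := norm_coord_enorm (x - p) i; rewrite !mxE.
Qed.

Lemma compact_enorm_cover K (r : V -> R) : compact K ->
  (forall p, K p -> 0 < r p) ->
  exists2 s : seq V, (forall p, p \in s -> K p) &
    forall x, K x -> exists2 p, p \in s & enorm (x - p) < r p.
Proof.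
move=> /[!compact_cover] cK r0.
have h0 p : K p -> 0 < r p / 2 / (d.+1)%:R by move=> Kp; rewrite !divr_gt0 ?r0.
have [||s sK sc] := cK _ K (fun p => (ball p (r p / 2 / (d.+1)%:R))^°).
- by move=> p _; exact: open_interior.
- move=> x Kx; exists x => //; apply: nbhs_singleton; apply: nbhs_interior.
  by apply: nbhsx_ballx; exact: h0.
exists (finmap.enum_fset s) => [p ps|x Kx]; first by have := sK _ ps; rewrite inE.
have [p ps xp] := sc _ Kx; exists p => //.
apply: le_lt_trans (ball_enorm (interior_subset xp)) _.
by have := sK _ ps; rewrite inE => /r0; lra.
Qed.

Lemma compact_net K e : compact K -> 0 < e ->
  exists s : seq V, forall x, K x -> exists2 p, p \in s & enorm (x - p) < e.
Proof.
by move=> cK e0; have [//|s _ ?] := compact_enorm_cover (r := fun=> e) cK; exists s.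
Qed.

(** The Lebesgue number lemma in centred form: the ball of radius [e] about [q] lies in the ball of
    radius [2 * r p] about [p]. The number [e] is the least radius of a finite subcover. *)
Lemma lebesgue_radius K (r : V -> R) : compact K ->
  (forall p, K p -> 0 < r p) ->
  exists2 e, 0 < e &
    forall q, K q -> exists p, [/\ K p, enorm (q - p) < r p & e <= r p].
Proof.
move=> cK r0; have [s sK sc] := compact_enorm_cover cK r0.
have [e e0 es] : exists2 e, 0 < e & forall p, p \in s -> e <= r p.
  elim: s {sc} sK => [|p s IH] sK; first by exists 1.
  have [|e e0 es] := IH; first by move=> q qs; apply: sK; rewrite inE qs orbT.
  exists (Num.min e (r p)) => [|q].
    by rewrite lt_min e0 r0 //; apply: sK; exact: mem_head.
  by rewrite inE => /predU1P[->|/es]; rewrite ge_min ?lexx ?orbT // => ->.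
exists e => // q Kq; have [p ps qp] := sc _ Kq.
by exists p; split=> //; [exact: sK|exact: es].
Qed.

(** An inequality that fails strictly at [p] fails on a ball around [p], by Cauchy-Schwarz. The
    radius [2 * r] leaves room for moving the centre by [r]. *)
Lemma halfspace_radius (hs : seq (V * R)) p e : 0 < e ->
  exists2 r, 0 < r <= e & forall h, h \in hs ->
    forall y, enorm (y - p) < 2 * r -> dot h.1 y < h.2 -> dot h.1 p <= h.2.
Proof.
move=> e0; elim: hs => [|h hs [r /andP[r0 re] IH]].
  by exists e => //; rewrite e0 lexx.
have [hp|hp] := leP (dot h.1 p) h.2.
  exists r => [|g]; first by rewrite r0.
  by rewrite inE => /predU1P[-> //|]; exact: IH.
set a := dot h.1 p - h.2; have a0 : 0 < a by rewrite subr_gt0.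
have n0 : 0 <= enorm h.1 := enorm_ge0 _.
(* At distance below [2 * r'] the value of [h.1] drops by at most the gap [a]; the summand 1 covers
   [h.1 = 0]. *)
pose r' := Num.min r (a / (2 * (enorm h.1 + 1))).
have r'0 : 0 < r' by rewrite lt_min r0 divr_gt0 //; lra.
exists r' => [|g]; first by rewrite r'0 (le_trans _ re) // ge_min lexx.
rewrite inE => /predU1P[->|ghs] y yr; last first.
  by apply: IH => //; apply: lt_le_trans yr _; rewrite ler_pM2l // ge_min lexx.
have := cauchy_schwarz h.1 (p - y); rewrite dotBr enorm_distC => cs hy.
suff : enorm h.1 * enorm (y - p) <= a by rewrite /a in a0 *; lra.
have {}yr : enorm (y - p) <= a / (enorm h.1 + 1).
  apply: le_trans (ltW yr) _.
  have : r' <= a / (2 * (enorm h.1 + 1)) by rewrite ge_min lexx orbT.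
  by rewrite invfM mulrCA => ?; lra.
apply: le_trans (ler_wpM2l n0 yr) _.
rewrite mulrA ler_pdivrMr; last by lra.
by rewrite [leRHS]mulrDr mulr1 mulrC lerDl ltW.
Qed.

(* A ball of radius [e] can only meet a polytope bounded by [hs] if the closure
   of that polytope contains [p]. *)
Lemma lebesgue_halfspaces K (hs : seq (V * R)) e0 : compact K -> 0 < e0 ->
  exists2 e, 0 < e & forall q, K q -> exists p,
    [/\ K p, enorm (q - p) < e0 & forall h, h \in hs ->
      forall y, enorm (y - q) < e -> dot h.1 y < h.2 -> dot h.1 p <= h.2].
Proof.
move=> cK e00.
have /choice[r rP] p : exists r, 0 < r <= e0 /\ forall h, h \in hs ->
    forall y, enorm (y - p) < 2 * r -> dot h.1 y < h.2 -> dot h.1 p <= h.2.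
  by have [r ? ?] := halfspace_radius hs p e00; exists r.
have [|e ep eP] := lebesgue_radius (r := r) cK.
  by move=> p _; have [/andP[]] := rP p.
exists e => // q /eP[p [Kp qp er]]; have [/andP[_ re] pP] := rP p.
exists p; split=> // [|h hhs y yq]; first exact: lt_le_trans qp re.
apply: pP => //; apply: le_lt_trans (enorm_triangle q y p) _; lra.
Qed.

(** The identity from the Euclidean metric to [rho] is continuous on the compact set [X], hence
    uniformly continuous. *)
Lemma std_metric_unif X (rho : V -> V -> R) e : compact X -> std_metric X rho ->
  0 < e -> exists2 r, 0 < r &
    forall x y, X x -> X y -> enorm (x - y) < r -> rho x y < e.
Proof.
move=> cX mX e0.
have /choice[r rP] p : exists r, X p -> 0 < r /\
    forall y, X y -> enorm (y - p) < 2 * r -> rho p y < e / 2.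
  have [Xp|] := pselect (X p); last by exists 0.
  have /(std_metric_nbhs mX Xp) : exists2 a : R, 0 < a &
    forall y, X y -> rho p y < a -> [set y | rho p y < e / 2] y.
    by exists (e / 2) => //; rewrite divr_gt0.
  rewrite /within /= => /nbhs_ballP[a /= a0 aP].
  exists (a / 2) => _; split=> [|y Xy yp]; first by rewrite divr_gt0.
  by apply: aP => //; apply: enorm_ball; rewrite mulrC divfK in yp.
have [|a a0 aP] := lebesgue_radius (r := r) cX; first by move=> p /rP[].
exists a => // x y Xx Xy xy; have [p [Xp xp ap]] := aP _ Xx.
have [rp pP] := rP _ Xp.
apply: le_lt_trans (std_metric_triangle mX Xx Xp Xy) _.
rewrite (std_metric_sym mX Xx Xp).
have h1 : rho p x < e / 2 by apply: pP => //; lra.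
have h2 : rho p y < e / 2; last by lra.
apply: pP => //; apply: le_lt_trans (enorm_triangle x y p) _.
rewrite enorm_distC; lra.
Qed.

(** A compact set containing the Euclidean unit sphere, over which Lebesgue numbers and nets of
    directions are taken. *)
Lemma compact_unit_box : compact [set x : V | forall i, `|x i 0| <= 1].
Proof.
have cB : compact [set v : 'rV[R]_d | forall i, v ord0 i \in `[-1, 1]].
  have := @rV_compact R d (fun=> `[-1, 1]%classic); apply => _.
  exact: segment_compact.
have -> : [set x : V | forall i, `|x i 0| <= 1] =
    trmx @` [set v : 'rV[R]_d | forall i, v ord0 i \in `[-1, 1]].
  apply/seteqP; split=> [x x1|_ [x x1 <-] i].
    exists x^T; last exact: trmxK.
    by move=> i; rewrite mxE in_itv /= -ler_norml.
  by have := x1 i; rewrite /= mxE in_itv /= -ler_norml.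
apply: continuous_compact cB.
apply: continuous_subspaceT => x A /= /nbhs_ballP[e /= e0 eA].
apply/nbhs_ballP; exists e => //= y [_ xy].
by apply: eA; split=> // i j; rewrite !mxE; exact: xy.
Qed.

End Compactness.

(** * Tangent cones along flags *)

Section TangentCone.
Context {R : realType} {d : nat}.
Local Notation V := 'cV[R]_d.
Implicit Types (S A B : set V) (x y p u v w : V) (s t c : R).

(** The condition [0 < t] leaves out [x] itself, so that a polyhedron also has tangent directions at
    its boundary points. *)
Definition tangent x S : set V :=
  [set v | exists2 t0 : R, 0 < t0 & forall t, 0 < t < t0 -> S (x + t *: v)].

Definition cone S := forall c v, 0 < c -> S v -> S (c *: v).

Definition invariant_along u S := forall s v, S v -> S (v + s *: u).

Lemma tangentI x A B : tangent x (A `&` B) = tangent x A `&` tangent x B.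
Proof.
apply/seteqP; split=> [v [t t0 tP]|v [[t t0 tA] [s s0 sB]]].
  by split; exists t => // r /tP[].
exists (Num.min t s) => [|r]; first by rewrite lt_min t0.
by rewrite lt_min => /and3P[r0 rt rs]; split; [apply: tA|apply: sB]; apply/andP.
Qed.

Lemma tangent_nonempty x S : tangent x S !=set0 -> S !=set0.
Proof.
move=> [v [t t0 tS]]; exists (x + (t / 2) *: v).
by apply: tS; lra.
Qed.

Lemma tangent_cone x S : cone (tangent x S).
Proof.
move=> c v c0 [t t0 tS]; exists (t / c) => [|s]; first by rewrite divr_gt0.
move=> /andP[s0 st]; rewrite scalerA; apply: tS.
by rewrite mulr_gt0 //= -ltr_pdivlMr.
Qed.

Lemma tangent_preimage (A : 'M[R]_d) (b : V) x S :
  tangent x [set y | S (A *m y + b)] = [set v | tangent (A *m x + b) S (A *m v)].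
Proof.
apply/seteqP; split=> v [t t0 tS]; exists t => // s /tS /=;
  by rewrite mulmxDr -scalemxAr addrAC.
Qed.

Lemma tangentZ c v S : cone S -> 0 < c -> tangent (c *: v) S = tangent v S.
Proof.
move=> cS; have sub c' v' : 0 < c' -> tangent v' S `<=` tangent (c' *: v') S.
  move=> c0 w [t t0 tS]; exists (c' * t) => [|s /andP[s0 st]]; first exact: mulr_gt0.
  have -> : c' *: v' + s *: w = c' *: (v' + (s / c') *: w).
    by rewrite scalerDr scalerA mulrC divfK // gt_eqF.
  by apply: cS => //; apply: tS; rewrite divr_gt0 //= ltr_pdivrMr // mulrC.
move=> c0; apply/seteqP; split; last exact: sub.
rewrite -[X in _ `<=` tangent X _](scalerK (a := c)) ?gt_eqF //.
by apply: sub; rewrite invr_gt0.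
Qed.

Lemma tangent_translate u v S :
  invariant_along u S -> tangent (v + u) S = tangent v S.
Proof.
move=> iS; have sub c v' : tangent v' S `<=` tangent (v' + c *: u) S.
  by move=> w [t t0 tS]; exists t => // s /tS /(iS c); rewrite addrAC.
apply/seteqP; split; last by rewrite -[u]scale1r; exact: sub.
by have := sub (-1) (v + u); rewrite scaleN1r addrK.
Qed.

Lemma tangent_invariant u v S :
  invariant_along u S -> invariant_along u (tangent v S).
Proof.
move=> iS s w [t t0 tS]; exists t => // r /tS /(iS (r * s)).
by rewrite scalerDr scalerA addrA.
Qed.

(** The identity [v + r (w + s v) = (1 + r s) (v + r / (1 + r s) w)] turns a shift along [v] into a
    rescaling, which a cone absorbs. *)
Lemma tangent_invariant_self v S : cone S -> invariant_along v (tangent v S).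
Proof.
move=> cS s w [t t0 tS].
have a0 : 0 < 2 * (`|s| + 1) by have := normr_ge0 s; lra.
(* These bounds give [1 + r * s > 1 / 2], hence [r / (1 + r * s) < 2 * r < t]. *)
exists (Num.min (t / 2) (2 * (`|s| + 1))^-1) => [|r].
  by rewrite lt_min divr_gt0 //= invr_gt0.
rewrite lt_min => /and3P[r0 rt rs].
have hs : 2 * (r * (`|s| + 1)) < 1.
  by rewrite mulrCA -ltr_pdivlMr // div1r.
have h1 : 1 / 2 < 1 + r * s.
  have : - (r * s) <= r * `|s|.
    by rewrite -mulrN ler_wpM2l ?(ltW r0) // ler_normr lexx orbT.
  by move: hs; rewrite mulrDr mulr1; lra.
have h0 : 0 < 1 + r * s by lra.
have -> : v + r *: (w + s *: v) = (1 + r * s) *: (v + (r / (1 + r * s)) *: w).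
  rewrite !scalerDr scalerDl scale1r !scalerA mulrCA mulfV ?gt_eqF // mulr1.
  by rewrite -!addrA; congr (_ + _); rewrite addrC.
apply: cS => //; apply: tS; rewrite divr_gt0 //= ltr_pdivrMr //.
have := ltr_pM2l t0 (1 / 2) (1 + r * s); rewrite h1; lra.
Qed.

(* The cone of the germs of [S] at [x] along the flag spanned by [vs], whose
   last direction comes first in [vs]. *)
Definition flag_tangent x (vs : seq V) S : set V :=
  foldr tangent (tangent x S) vs.

Lemma flag_tangent_cone x vs S : cone (flag_tangent x vs S).
Proof. by case: vs => [|v vs]; exact: tangent_cone. Qed.

Lemma flag_tangentI x vs A B : flag_tangent x vs (A `&` B) =
  flag_tangent x vs A `&` flag_tangent x vs B.
Proof. by elim: vs => [|v vs /= ->]; exact: tangentI. Qed.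

Lemma flag_tangent_nonempty x vs S : flag_tangent x vs S !=set0 -> S !=set0.
Proof. by elim: vs => [|v vs IH] /tangent_nonempty. Qed.

Lemma flag_tangent_invariant x vs S u :
  u \in vs -> invariant_along u (flag_tangent x vs S).
Proof.
elim: vs => //= v vs IH; rewrite inE => /predU1P[->|/IH].
  exact/tangent_invariant_self/flag_tangent_cone.
exact: tangent_invariant.
Qed.

Lemma flag_tangent_invariant_proj x vs S y :
  invariant_along (orthproj vs y) (flag_tangent x vs S).
Proof.
move=> c; rewrite /orthproj big_seq; elim/big_rec: _ => [|u z uvs IH] w Sw.
  by rewrite scaler0 addr0.
rewrite scalerDr addrA; apply: IH.
by rewrite scalerA; exact: flag_tangent_invariant.
Qed.

Lemma flag_tangent_proj x vs S y v :
  flag_tangent x vs S (v + orthproj vs y) <-> flag_tangent x vs S v.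
Proof.
split=> [|/(flag_tangent_invariant_proj y 1)]; last by rewrite scale1r.
by move=> /(flag_tangent_invariant_proj y (-1)); rewrite scaleN1r addrK.
Qed.

(** A similarity acts on directions through its rotation alone: its factor [c] only rescales vectors
    and is absorbed by the cone property. *)
Lemma flag_tangent_preimage c (Q : 'M[R]_d) (b : V) x vs S : 0 < c ->
  flag_tangent x vs [set y | S (c *: (Q *m y) + b)] =
  [set v | flag_tangent (c *: (Q *m x) + b) (map (mulmx Q) vs) S (Q *m v)].
Proof.
move=> c0; elim: vs => [|u vs IH] /=.
  have -> : [set y | S (c *: (Q *m y) + b)] = [set y | S ((c *: Q) *m y + b)].
    by apply/seteqP; split=> y /=; rewrite scalemxAl.
  rewrite tangent_preimage; apply/seteqP; split=> v /=; rewrite -!scalemxAl.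
    move=> /(tangent_cone (c := c^-1)); rewrite invr_gt0.
    by move=> /(_ c0); rewrite scalerK ?gt_eqF.
  exact: tangent_cone.
rewrite -/(flag_tangent _ _ _) IH.
have := tangent_preimage Q 0 u
  (flag_tangent (c *: (Q *m x) + b) (map (mulmx Q) vs) S).
by rewrite addr0 => <-; congr tangent; apply/seteqP; split=> y /=; rewrite addr0.
Qed.

End TangentCone.

(** * Open polyhedra and their tangent cones *)

Section Polyhedron.
Context {R : realType} {d : nat}.
Local Notation V := 'cV[R]_d.
Implicit Types (hs : seq (V * R)) (x y p u v w : V).

Definition polyhedron hs : set V :=
  [set x | forall h, h \in hs -> dot h.1 x < h.2].

Lemma polyhedron_cons h hs :
  polyhedron (h :: hs) = polyhedron [:: h] `&` polyhedron hs.
Proof.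
apply/seteqP; split=> [x hx|x [xh hx] g].
  split=> g; last by move=> gh; apply: hx; rewrite inE gh orbT.
  by rewrite mem_seq1 => /eqP ->; apply: hx; exact: mem_head.
by rewrite inE => /predU1P[->|/hx //]; apply: xh; rewrite inE.
Qed.

Lemma polyhedron_cat hs1 hs2 :
  polyhedron (hs1 ++ hs2) = polyhedron hs1 `&` polyhedron hs2.
Proof.
apply/seteqP; split=> [x hx|x [hx1 hx2] g].
  by split=> g gh; apply: hx; rewrite mem_cat gh ?orbT.
by rewrite mem_cat => /orP[/hx1|/hx2].
Qed.

(** Constraints slack at [p] persist nearby, tight ones restrict [v], and a violated one rules out
    every direction. *)
Lemma tangent_polyhedron hs p v : tangent p (polyhedron hs) v <->
  forall h, h \in hs -> dot h.1 p < h.2 \/ (dot h.1 p = h.2 /\ dot h.1 v < 0).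
Proof.
elim: hs => [|h hs IH]; first by split=> // _; exists 1.
rewrite polyhedron_cons tangentI; split=> [[[t t0 tP] /IH hv] g|hv].
  rewrite inE => /predU1P[{g}->|/hv //].
  have tP' s : 0 < s < t -> dot h.1 p + s * dot h.1 v < h.2.
    by move=> /tP /(_ h (mem_head _ _)); rewrite dotDr dotZr.
  have [|pg|ph] := ltgtP (dot h.1 p) h.2; first by left.
    exfalso; pose a := dot h.1 p - h.2; have a0 : 0 < a by rewrite /a subr_gt0.
    have b0 : 0 < 2 * (`|dot h.1 v| + 1) by have := normr_ge0 (dot h.1 v); lra.
    (* This [s] lies below [t] and changes the value of [h.1] by at most [a / 2], too little to
       repair the violated constraint. *)
    pose s := Num.min (t / 2) (a / (2 * (`|dot h.1 v| + 1))).
    have s0 : 0 < s by rewrite lt_min !divr_gt0.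
    have st : s <= t / 2 by rewrite ge_min lexx.
    have := tP' s; rewrite s0 /= => /(_ ltac:(lra)).
    have : s * (2 * (`|dot h.1 v| + 1)) <= a.
      by rewrite -ler_pdivlMr // ge_min lexx orbT.
    have : - (s * dot h.1 v) <= s * `|dot h.1 v|.
      by rewrite -mulrN ler_wpM2l ?(ltW s0) // ler_normr lexx orbT.
    by rewrite /a; nra.
  right; split=> //; have := tP' (t / 2) ltac:(lra).
  by rewrite ph gtrDl pmulr_rlt0 // divr_gt0.
split; last by apply/IH => g ghs; apply: hv; rewrite inE ghs orbT.
have [hp|[hp hv0]] := hv h (mem_head _ _); last first.
  exists 1 => // t /andP[t0 _] g; rewrite mem_seq1 => /eqP ->.
  by rewrite dotDr dotZr hp gtrDl pmulr_rlt0.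
pose a := h.2 - dot h.1 p; have a0 : 0 < a by rewrite /a subr_gt0.
have b0 : 0 < `|dot h.1 v| + 1 by have := normr_ge0 (dot h.1 v); lra.
exists (a / (`|dot h.1 v| + 1)) => [|t /andP[t0]]; first by rewrite divr_gt0.
rewrite ltr_pdivlMr // => ta g; rewrite mem_seq1 => /eqP ->.
rewrite dotDr dotZr.
have : t * dot h.1 v <= t * `|dot h.1 v| by rewrite ler_wpM2l ?(ltW t0) // ler_norm.
by move: ta; rewrite /a; lra.
Qed.

(** Convexity: the segment from a point of the closed polyhedron to a point of the open one enters
    the open one at once. *)
Lemma tangent_polyhedron_sub hs p y : polyhedron hs y ->
  (forall h, h \in hs -> dot h.1 p <= h.2) -> tangent p (polyhedron hs) (y - p).
Proof.
move=> hy hp; apply/tangent_polyhedron => h hhs; rewrite dotBr.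
have := hp h hhs; rewrite le_eqVlt => /predU1P[ph|]; last by left.
by right; split=> //; rewrite ph subr_lt0 hy.
Qed.

Lemma tangent_polyhedronE hs p : tangent p (polyhedron hs) !=set0 ->
  tangent p (polyhedron hs) =
  polyhedron [seq (h.1, 0) | h <- hs & dot h.1 p == h.2].
Proof.
move=> [w /tangent_polyhedron hw]; apply/seteqP; split=> v.
  move=> /tangent_polyhedron hv _ /mapP[h /[!mem_filter] /andP[/eqP ph hhs] ->] /=.
  by have [|[]//] := hv _ hhs; rewrite ph ltxx.
move=> hv; apply/tangent_polyhedron => h hhs.
have [|[ph _]] := hw _ hhs; first by left.
right; split=> //; apply: (hv (h.1, 0)); apply/mapP; exists h => //.
by rewrite mem_filter ph eqxx.
Qed.

(** Whatever the point and the flag, the cone is cut out by normals from [hs], now with bound 0.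
    This finiteness yields Lebesgue numbers uniform in [x] and [vs]. *)
Lemma flag_tangent_polyhedronE x vs hs :
  flag_tangent x vs (polyhedron hs) !=set0 ->
  exists2 hs', (forall h, h \in hs' -> exists2 g, g \in hs & h = (g.1, 0)) &
    flag_tangent x vs (polyhedron hs) = polyhedron hs'.
Proof.
rewrite /flag_tangent; elim: vs => [/tangent_polyhedronE /= ->|v vs IH] /=.
  by eexists; last reflexivity; move=> h /mapP[g /[!mem_filter]/andP[_ ghs] ->]; exists g.
move=> /[dup] /tangent_nonempty /IH[hs' sub] ->.
move=> /tangent_polyhedronE ->; eexists; last reflexivity.
by move=> h /mapP[g /[!mem_filter]/andP[_ /sub[k khs ->]] ->]; exists k.
Qed.

Lemma polyhedron_open_along hs y z : polyhedron hs y ->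
  exists2 t : R, 0 < t & polyhedron hs (y + t *: z).
Proof.
move=> hy; have [t t0 tP] : tangent y (polyhedron hs) z.
  by apply/tangent_polyhedron => h /hy; left.
exists (t / 2); first by rewrite divr_gt0.
by apply: tP; lra.
Qed.

(** Along a complete flag every vector equals its projection, so the cone is invariant under all
    translations. *)
Lemma flag_tangent_full x vs hs : orthonormal_seq vs -> size vs = d ->
  flag_tangent x vs (polyhedron hs) !=set0 ->
  flag_tangent x vs (polyhedron hs) = setT.
Proof.
move=> ON sz [y hy]; apply/seteqP; split=> // v _.
have pE w : w = orthproj vs w.
  apply/eqP; rewrite -subr_eq0; apply/eqP; apply: (orthonormal_full ON sz) => u uvs.
  by rewrite dotBr dot_proj // subrr.
rewrite (pE v) -[orthproj vs v]add0r; apply/flag_tangent_proj.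
by apply/(flag_tangent_proj x vs _ y); rewrite add0r -pE.
Qed.

(** Invariance along [vs] allows the projection to be removed from a vector of the cone, and the
    cone property allows the rest to be normalised. *)
Lemma flag_tangent_unit x vs hs : orthonormal_seq vs -> (size vs < d)%N ->
  flag_tangent x vs (polyhedron hs) !=set0 ->
  exists q, [/\ enorm q = 1, forall u, u \in vs -> dot u q = 0 &
    flag_tangent x vs (polyhedron hs) q].
Proof.
move=> ON sz S0; have [y Sy] := S0.
have [z z0 zvs] := orthonormal_ext sz.
have perp w u : u \in vs -> dot u (w - orthproj vs w) = 0.
  by move=> uvs; rewrite dotBr dot_proj // subrr.
(* The rest must not vanish. Since the cone is open, a vector in the span of [vs] can be pushed off
   it along [z]. *)
have [w w0 Sw] : exists2 w, w - orthproj vs w != 0 & flag_tangent x vs (polyhedron hs) w.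
  have [y0|] := eqVneq (y - orthproj vs y) 0; last by exists y.
  have [hs' _ SE] := flag_tangent_polyhedronE S0.
  move: Sy; rewrite SE => /(polyhedron_open_along z)[t t0 Sz].
  exists (y + t *: z) => //; apply/eqP => /(congr1 (dot z)); apply/eqP.
  rewrite dot0r dotBr dotDr dotZr.
  rewrite [dot z (orthproj _ _)]dotC dot_proj_eq0 // subr0.
  have -> : dot z y = 0.
    by move/eqP : y0; rewrite subr_eq0 => /eqP ->; rewrite dotC dot_proj_eq0.
  rewrite add0r mulf_neq0 //; first by rewrite gt_eqF.
  by apply: contra z0 => /eqP /dot_eq0 ->.
have n0 : 0 < enorm (w - orthproj vs w).
  rewrite lt_def enorm_ge0 andbT; apply: contra w0 => /eqP /enorm_eq0 ->.
  exact: eqxx.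
exists ((enorm (w - orthproj vs w))^-1 *: (w - orthproj vs w)); split.
- by rewrite enormZ gtr0_norm ?invr_gt0 // mulVf // gt_eqF.
- by move=> u uvs; rewrite dotZr perp // mulr0.
- apply: flag_tangent_cone; first by rewrite invr_gt0.
  by apply/(flag_tangent_proj x vs _ w); rewrite subrK.
Qed.

End Polyhedron.

(** * Subexponential multiplicity *)

Section Few.
Context {R : realType}.

(** An upper bound on a cardinality: the list may contain elements outside [P], and [N] is real
    because exponential bounds are substituted for it. *)
Definition few (T : eqType) (P : T -> Prop) (N : R) : Prop :=
  exists2 s : seq T, (size s)%:R <= N & forall w, P w -> w \in s.

Lemma few_sub (T : eqType) (P P' : T -> Prop) N :
  (forall w, P' w -> P w) -> few P N -> few P' N.
Proof. by move=> PP' [s sN sP]; exists s => // w /PP' /sP. Qed.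

Lemma few_bind (T1 T2 T3 : eqType) (A : T1 -> Prop) (B : T1 -> T2 -> Prop)
    (P : T3 -> Prop) (g : T1 -> T2 -> T3) (N1 N2 : R) : 0 <= N2 ->
  few A N1 -> (forall u, A u -> few (B u) N2) ->
  (forall w, P w -> exists u v, [/\ A u, B u v & w = g u v]) ->
  few P (N1 * N2).
Proof.
move=> N20 [s sN sA] fB PAB.
have /choice[t tP] u : exists t : seq T2, (size t)%:R <= N2 /\
    (A u -> forall v, B u v -> v \in t).
  have [/fB[t tN tB]|nA] := pselect (A u); first by exists t.
  by exists [::].
exists [seq g u v | u <- s, v <- t u] => [|w /PAB[u [v [Au Buv ->]]]].
  rewrite size_allpairs_dep; apply: le_trans (ler_wpM2r N20 sN).
  elim: s {sN sA} => [|u s IH] /=; first by rewrite mul0r.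
  by rewrite natrD -natr1 mulrDl mul1r addrC lerD // (tP u).1.
by apply/allpairsPdep; exists u, v; split; [exact: sA|exact: (tP u).2|].
Qed.

End Few.

Lemma few_le (R : realType) (T : eqType) (P : T -> Prop) (N N' : R) :
  N <= N' -> few P N -> few P N'.
Proof. by move=> NN' [s sN sP]; exists s => //; exact: le_trans NN'. Qed.

(** * Words, cylinders and their multiplicity *)

Section Conformal.
Context {R : realType} {d : nat} {I : finType}.
Local Notation V := 'cV[R]_d.
Context (H : I -> seq (V * R)) (c : I -> R) (Q : I -> 'M[R]_d) (b : I -> V).
Implicit Types (w : seq I) (x y p q v : V) (vs : seq V).

Definition step i x : V := c i *: (Q i *m x) + b i.

Definition orbit_end w x : V := foldl (fun y i => step i y) x w.

Definition rotation w : 'M[R]_d := foldl (fun M i => Q i *m M) 1%:M w.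

Definition dilation w : R := \prod_(i <- w) c i.

Fixpoint cylinder w : set V :=
  if w is i :: w' then polyhedron (H i) `&` [set x | cylinder w' (step i x)]
  else setT.

Lemma rotation_rcons w i : rotation (rcons w i) = Q i *m rotation w.
Proof. by rewrite /rotation foldl_rcons. Qed.

Lemma rotation_cons i w : rotation (i :: w) = rotation w *m Q i.
Proof.
elim/last_ind: w => [|w j IH]; first by rewrite /rotation /= mulmx1 mul1mx.
by rewrite -rcons_cons !rotation_rcons IH mulmxA.
Qed.

Lemma orbit_end_cat u w x : orbit_end (u ++ w) x = orbit_end w (orbit_end u x).
Proof. exact: foldl_cat. Qed.

Lemma cylinder_cat u w :
  cylinder (u ++ w) = cylinder u `&` [set x | cylinder w (orbit_end u x)].
Proof.
elim: u => [|i u IH] /=; first by rewrite setTI.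
by rewrite IH; apply/seteqP; split=> [x [? [? ?]]|x [[? ?] ?]].
Qed.

Fixpoint cylinder_halfspaces w : seq (V * R) :=
  if w is i :: w' then
    H i ++ [seq (c i *: ((Q i)^T *m h.1), h.2 - dot h.1 (b i)) |
              h <- cylinder_halfspaces w']
  else [::].

Lemma cylinderE w : cylinder w = polyhedron (cylinder_halfspaces w).
Proof.
elim: w => [|i w IH] /=; first by apply/seteqP; split.
rewrite polyhedron_cat IH; congr (_ `&` _).
have E x (h : V * R) : (dot (c i *: ((Q i)^T *m h.1)) x < h.2 - dot h.1 (b i)) =
    (dot h.1 (step i x) < h.2).
  by rewrite /step dotDr dotZr dotZl dot_mulmxr ltrBrDr.
apply/seteqP; split=> x hx h; last first.
  move=> hw; rewrite -E.
  apply: (hx (c i *: ((Q i)^T *m h.1), h.2 - dot h.1 (b i))).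
  by apply/mapP; exists h.
by case/mapP => g gw -> /=; rewrite E; exact: hx.
Qed.

(** One finite list serves all words of length [m], so a Lebesgue number for it depends on [m]
    only. *)
Lemma halfspaces_of_size m : exists hs : seq (V * R),
  forall w, size w = m -> {subset cylinder_halfspaces w <= hs}.
Proof.
exists (flatten [seq cylinder_halfspaces (val t) | t <- enum {: m.-tuple I}]).
move=> w wm h hw; apply/flattenP; exists (cylinder_halfspaces w) => //.
by subst m; apply/mapP; exists (in_tuple w); rewrite ?mem_enum.
Qed.

Lemma cylinder_inj u w x :
  (forall i j y, polyhedron (H i) y -> polyhedron (H j) y -> i = j) ->
  size u = size w -> cylinder u x -> cylinder w x -> u = w.
Proof.
move=> disj; elim: u w x => [|i u IH] [|j w] x //= [uw] [ix ux] [jx wx].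
have ij := disj _ _ _ ix jx; subst j; congr (_ :: _); exact: IH wx.
Qed.

Context (c_gt0 : forall i, 0 < c i) (Q_orth : forall i, orthogonal_mx (Q i)).

Lemma dilation_gt0 w : 0 < dilation w.
Proof. by apply: prodr_gt0. Qed.

Lemma rotation_orthogonal w : orthogonal_mx (rotation w).
Proof.
elim/last_ind: w => [|w i IH]; first exact: orthogonal_mx1.
by rewrite rotation_rcons; exact: orthogonal_mxM.
Qed.

Lemma orbit_endB w x y :
  orbit_end w x - orbit_end w y = dilation w *: (rotation w *m (x - y)).
Proof.
rewrite /dilation; elim: w x y => [|i w IH] x y /=.
  by rewrite big_nil scale1r /rotation /= mul1mx.
rewrite IH /step opprD addrACA subrr addr0 -scalerBr -mulmxBr -scalemxAr scalerA.
by rewrite rotation_cons big_cons mulmxA mulrC.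
Qed.

Lemma flag_tangent_cylinder_cat x vs u w y :
  flag_tangent x vs (cylinder (u ++ w)) y ->
  flag_tangent x vs (cylinder u) y /\
  flag_tangent (orbit_end u x) (map (mulmx (rotation u)) vs) (cylinder w)
    (rotation u *m y).
Proof.
rewrite cylinder_cat flag_tangentI => -[uy wy]; split=> //.
elim: u x vs y wy {uy} => [|i u IH] x vs y.
  rewrite /rotation /= mul1mx; congr (flag_tangent _ _ _ _).
  by rewrite -[LHS]map_id; apply: eq_map => v; rewrite mul1mx.
rewrite (flag_tangent_preimage (c := c i) (Q i) (b i) x vs
  [set x | cylinder w (orbit_end u x)] (c_gt0 i)) => /IH.
by rewrite rotation_cons mulmxA -map_comp; congr (flag_tangent _ _ _ _);
  apply: eq_map => v /=; rewrite mulmxA.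
Qed.

(** Directions move by isometries, so after each block the image of [y] is still within the same [e]
    of the image of [q]. The hypothesis applies to all [l] blocks and the counts multiply. *)
Lemma few_blocks k m (D e : R) : 0 <= D ->
  (forall x vs q, size vs = k -> orthonormal_seq vs -> enorm q = 1 ->
    (forall u, u \in vs -> dot u q = 0) ->
    few (fun w => size w = m /\
      exists2 y, flag_tangent x vs (cylinder w) y & enorm (y - q) < e) D) ->
  forall l x vs q, size vs = k -> orthonormal_seq vs -> enorm q = 1 ->
    (forall u, u \in vs -> dot u q = 0) ->
    few (fun w => size w = (l * m)%N /\
      exists2 y, flag_tangent x vs (cylinder w) y & enorm (y - q) < e) (D ^+ l).
Proof.
move=> D0 fewm; elim=> [|l IH] x vs q sz ON q1 qvs.
  by exists [:: [::]] => // w [/size0nil -> _]; exact: mem_head.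
rewrite exprS; pose A u := size u = m /\
      exists2 y, flag_tangent x vs (cylinder u) y & enorm (y - q) < e.
pose B u w := size w = (l * m)%N /\ exists2 y,
  flag_tangent (orbit_end u x) (map (mulmx (rotation u)) vs) (cylinder w) y &
  enorm (y - rotation u *m q) < e.
apply: (few_bind (A := A) (B := B) (g := cat)); first exact: exprn_ge0.
- exact: fewm.
- move=> u _; have oQ := rotation_orthogonal u; apply: IH.
  + by rewrite size_map.
  + exact: orthonormal_map.
  + by rewrite enorm_orthogonal.
  + by move=> _ /mapP[v vvs ->]; rewrite dot_orthogonal // qvs.
- move=> w [sw [y wy yq]]; exists (take m w), (drop m w).
  rewrite -(cat_take_drop m w) in wy.
  have [uy {}wy] := flag_tangent_cylinder_cat wy.
  split; last by rewrite cat_take_drop.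
    by split; [rewrite size_takel // sw mulSn leq_addr|exists y].
  split; first by rewrite size_drop sw mulSn addKn.
  exists (rotation (take m w) *m y) => //.
  by rewrite -mulmxBr enorm_orthogonal //; exact: rotation_orthogonal.
Qed.

Context (disj : forall i j y, polyhedron (H i) y -> polyhedron (H j) y -> i = j).

Let mult_bound k m (N : R) := forall x vs, orthonormal_seq vs -> size vs = k ->
  few (fun w => size w = m /\ flag_tangent x vs (cylinder w) !=set0) N.

(** At a complete flag every nonempty cone is the whole space, so any two such cylinders intersect
    and their words agree by disjointness of the cells. *)
Let mult_bound_top m : mult_bound d m 1.
Proof.
move=> x vs ON sz.
have [[w0 [s0 t0]]|no] :=
  pselect (exists w, size w = m /\ flag_tangent x vs (cylinder w) !=set0); last first.
  by exists [::] => // w wP; exfalso; apply: no; exists w.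
exists [:: w0] => // w [sw tw]; rewrite mem_seq1; apply/eqP.
have full u : flag_tangent x vs (cylinder u) !=set0 ->
    flag_tangent x vs (cylinder u) = setT.
  by rewrite cylinderE => ?; exact: flag_tangent_full.
have [y [wy w0y]] : cylinder w `&` cylinder w0 !=set0.
  apply: (@flag_tangent_nonempty _ _ x vs); rewrite flag_tangentI.
  by rewrite (full _ tw) (full _ t0) setTI; exists 0.
exact: (cylinder_inj disj (etrans sw (esym s0)) wy w0y).
Qed.

(** By the Lebesgue number, the cones coming within [e] of [q] all have one direction [p] in their
    closures; they are counted at the flag extended by [p]. *)
Let near_direction k m N : mult_bound k.+1 m N -> exists2 e, 0 < e &
  forall x vs q, size vs = k -> orthonormal_seq vs -> enorm q = 1 ->
    (forall u, u \in vs -> dot u q = 0) ->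
    few (fun w => size w = m /\
      exists2 y, flag_tangent x vs (cylinder w) y & enorm (y - q) < e) N.
Proof.
move=> mN; have [hs hsP] := halfspaces_of_size m.
have [e e0 eP] := lebesgue_halfspaces (K := [set x : V | forall i, `|x i 0| <= 1])
  [seq (h.1, 0) | h <- hs] (compact_unit_box (d := d)) (ltac:(lra) : 0 < 1 / 2 :> R).
exists e => // x vs q sz ON q1 qvs.
have [|p [_ qp pP]] := eP q; first by move=> i; rewrite -q1 norm_coord_enorm.
(* The direction [p] need not be orthogonal to [vs], but the cones at
   [vs] are invariant along [vs], so its normalised projection [p2] has the
   same tangent cones. *)
pose p1 := p - orthproj vs p.
have p1vs u : u \in vs -> dot u p1 = 0.
  by move=> uvs; rewrite dotBr dot_proj // subrr.
(* If [p] lay in the span of [vs], it would be orthogonal to the unit vector [q], hence at distance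
   at least 1 from it, against the bound [1 / 2]. *)
have n0 : 0 < enorm p1.
  rewrite lt_def enorm_ge0 andbT; apply/eqP => /enorm_eq0 /eqP.
  rewrite subr_eq0 => /eqP pE.
  have qp0 : dot q p = 0 by rewrite pE dotC dot_proj_eq0.
  have := enorm_sqr (q - p); rewrite !(dotBl, dotBr) (dotC p q) qp0 -enorm_sqr q1.
  have := dot_ge0 p; have := enorm_ge0 (q - p); nra.
pose p2 := (enorm p1)^-1 *: p1.
have p2n : enorm p2 = 1 by rewrite enormZ gtr0_norm ?invr_gt0 // mulVf ?gt_eqF.
have ON2 : orthonormal_seq (p2 :: vs).
  split=> // [|u uvs]; first by rewrite -enorm_sqr p2n expr1n.
  by rewrite dotC dotZr p1vs // mulr0.
have tE S : flag_tangent x (p2 :: vs) S = tangent p (flag_tangent x vs S).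
  rewrite /= -/(flag_tangent _ _ _) tangentZ ?invr_gt0 //; last exact: flag_tangent_cone.
  have := @tangent_translate _ _ (orthproj vs p) p1 (flag_tangent x vs S).
  by rewrite subrK => -> //; exact: flag_tangent_invariant_proj.
apply: few_sub (mN x (p2 :: vs) ON2 _); last by rewrite /= sz.
move=> w [sw [y wy yq]]; split=> //; rewrite tE.
rewrite cylinderE in wy *.
have [hs' hsub hE] := flag_tangent_polyhedronE (ex_intro _ y wy).
rewrite hE in wy *; exists (y - p); apply: tangent_polyhedron_sub => // h hhs.
have [g gw hg] := hsub _ hhs.
apply: (pP h _ y yq); last exact: wy.
by rewrite hg; apply/mapP; exists g => //; exact: hsP gw.
Qed.

(** The constant [C] is the size of a net of directions and does not depend on [l]. Every nonempty
    cone contains a unit direction close to a net point, and near one direction there are at most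
    [N ^+ l] words. *)
Let mult_bound_step k m N : (k < d)%N -> 0 <= N -> mult_bound k.+1 m N ->
  exists C : nat, forall l, mult_bound k (l * m) (C%:R * N ^+ l).
Proof.
move=> kd N0 mN; have [e e0 eP] := near_direction mN.
have [s sP] := compact_net (compact_unit_box (d := d)) (divr_gt0 e0 (ltr0n _ 2)).
exists (size s) => l x vs ON sz.
pose B (g : V) w := size w = (l * m)%N /\ exists q, [/\ enorm q = 1,
  forall u, u \in vs -> dot u q = 0, flag_tangent x vs (cylinder w) q &
  enorm (q - g) < e / 2].
apply: (few_bind (A := fun g => g \in s) (B := B) (g := fun _ w => w)).
- exact: exprn_ge0.
- by exists s.
- move=> g _.
  (* A net point need not be a unit vector orthogonal to [vs]; a nearby [q0] with these properties
     replaces it, at the price of halving [e]. *)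
  have [[q0 [q1 qvs q0g]]|no] := pselect (exists q, [/\ enorm q = 1,
    forall u, u \in vs -> dot u q = 0 & enorm (q - g) < e / 2]); last first.
    exists [::] => [|w [_ [q [q1 qvs _ qg]]]]; first exact: exprn_ge0.
    by exfalso; apply: no; exists q.
  have : few (fun w => size w = (l * m)%N /\
      exists2 y, flag_tangent x vs (cylinder w) y & enorm (y - q0) < e) (N ^+ l).
    exact: (few_blocks N0 eP l x sz ON q1 qvs).
  apply: few_sub => w [sw [q [_ _ wq qg]]]; split=> //; exists q => //.
  apply: le_lt_trans (enorm_triangle g q q0) _; rewrite (enorm_distC g); lra.
- move=> w [sw]; rewrite cylinderE => w0.
  have [|q [q1 qvs wq]] := flag_tangent_unit ON _ w0; first by rewrite sz.
  have [|g gs gq] := sP q; first by move=> i; rewrite -q1 norm_coord_enorm.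
  by exists g, w; split=> //; split=> //; exists q; split=> //; rewrite cylinderE.
Qed.

(** Induction on the codimension [j] of the flag: the longer flag has rate [delta / 2], and the
    other half of [delta] absorbs the constant [C] once [l] is large. *)
Let mult_bound_subexp j k : (k + j)%N = d -> forall (delta : R) N, 0 < delta ->
  exists2 m, (N <= m)%N & mult_bound k m (expR (delta * m%:R)).
Proof.
elim: j k => [|j IH] k kj delta N d0.
  exists N => // x vs ON sz.
  apply: (few_le _ (@mult_bound_top N x vs ON _)); last by rewrite sz -kj addn0.
  by rewrite -expR0 ler_expR mulr_ge0 // ltW.
have [|m m1 mN] := IH k.+1 _ (delta / 2) 1%N (divr_gt0 d0 (ltr0n _ 2)).
  by rewrite addSnnS.
have [|C CP] := mult_bound_step _ (expR_ge0 _) mN.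
  by rewrite -kj addnS ltnS leq_addr.
(* The second term gives [C <= l * (delta / 2)], hence [C <= exp (l * m * delta / 2)] since
   [1 <= m]; the first makes [l * m] at least [N]. *)
pose l := maxn N (Num.truncn (C%:R / (delta / 2))).+1.
exists (l * m)%N; first exact: leq_trans (leq_maxl N _) (leq_pmulr l m1).
move=> x vs ON sz; apply: few_le (CP l x vs ON sz).
have -> : expR (delta * (l * m)%:R) =
    expR (delta / 2 * m%:R) ^+ l * expR (delta / 2 * m%:R) ^+ l.
  by rewrite -!expRM_natl -expRD natrM; congr expR; field.
apply: ler_wpM2r; first exact/exprn_ge0/expR_ge0.
rewrite -expRM_natl; apply: le_trans (expR_ge1Dx _).
have lC : C%:R / (delta / 2) <= l%:R.
  apply: (@le_trans _ _ ((Num.truncn (C%:R / (delta / 2))).+1)%:R).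
    by rewrite ltW // truncnS_gt.
  by rewrite ler_nat leq_maxr.
have m1' : (1 : R) <= m%:R by rewrite ler1n.
move: lC; rewrite ler_pdivrMr ?divr_gt0 // => lC.
have : l%:R * (delta / 2) <= l%:R * (delta / 2 * m%:R).
  by rewrite [leRHS]mulrA ler_peMr // mulr_ge0 // divr_ge0 // ltW.
lra.
Qed.

Theorem multiplicity_subexp (delta : R) (N : nat) : 0 < delta ->
  exists2 m, (N <= m)%N & forall x,
    few (fun w => size w = m /\ tangent x (cylinder w) !=set0)
        (expR (delta * m%:R)).
Proof.
move=> d0; have [m Nm mP] := mult_bound_subexp (add0n d) N d0.
by exists m => // x; exact: (mP x [::]).
Qed.

End Conformal.

(** * Covers *)

Section Cover.
Context {R : realType} {d : nat}.
Local Notation V := 'cV[R]_d.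
Implicit Types (A B : V -> Prop) (D : V -> V -> Prop) (N r a : R).

(** The centres must lie in [A], just as the centres counted by [cover_num] lie in the domain of the
    iterate. *)
Definition has_cover A D N : Prop := exists s : seq V,
  [/\ (size s)%:R <= N, forall y, y \in s -> A y &
      forall x, A x -> exists2 y, y \in s & D x y].

Lemma has_cover_le A D N N' : N <= N' -> has_cover A D N -> has_cover A D N'.
Proof. by move=> NN' [s [sN sA sD]]; exists s; split=> //; exact: le_trans NN'. Qed.

Lemma has_cover1 A D : (forall x y, A x -> A y -> D x y) -> has_cover A D 1.
Proof.
move=> AD; have [[y Ay]|no] := pselect (exists y, A y).
  exists [:: y]; split=> // [z|x Ax]; first by rewrite mem_seq1 => /eqP ->.
  by exists y; [exact: mem_head|exact: AD].
by exists [::]; split=> // x Ax; exfalso; apply: no; exists x.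
Qed.

Lemma has_cover_bind (T : eqType) (P : T -> Prop) (B : T -> V -> Prop) A D N1 N2 :
  0 <= N2 -> few P N1 -> (forall u, P u -> has_cover (B u) D N2) ->
  (forall x, A x -> exists2 u, P u & B u x) ->
  (forall u x, P u -> B u x -> A x) -> has_cover A D (N1 * N2).
Proof.
move=> N20 [s sN sP] cB AB BA.
have /choice[t tP] u : exists t : seq V, (size t)%:R <= N2 /\
    (P u -> (forall y, y \in t -> B u y) /\
       forall x, B u x -> exists2 y, y \in t & D x y).
  have [/cB[t [tN tB tD]]|nP] := pselect (P u); first by exists t.
  by exists [::].
(* Labels outside [P] are dropped, since nothing places their chosen centres in [A]. *)
exists [seq y | u <- [seq u <- s | `[< P u >]], y <- t u]; split.
- rewrite size_allpairs_dep; apply: le_trans (ler_wpM2r N20 sN).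
  elim: s {sN sP} => [|u s IH] /=; first by rewrite mul0r.
  case: ifP => _ /=; rewrite -natr1 mulrDl mul1r.
    by rewrite natrD addrC lerD // (tP u).1.
  by rewrite (le_trans IH) // lerDl.
- move=> _ /allpairsPdep[u [y [/[!mem_filter]/andP[/asboolP Pu _] yt ->]]].
  by apply: (BA u) => //; exact: ((tP u).2 Pu).1.
- move=> x /AB[u Pu Bux]; have [y yt xy] := ((tP u).2 Pu).2 x Bux.
  exists y => //; apply/allpairsPdep; exists u, y; split=> //.
  by rewrite mem_filter sP // andbT; apply/asboolP.
Qed.

(** The centres are pulled back as well, which is why every point of [A'] must have a preimage in
    [A]. *)
Lemma has_cover_pull (g : V -> V) A D A' D' N : has_cover A' D' N ->
  (forall x, A x -> A' (g x)) -> (forall z, A' z -> exists2 y, A y & g y = z) ->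
  (forall x y, A x -> A y -> D' (g x) (g y) -> D x y) -> has_cover A D N.
Proof.
move=> [s [sN sA sD]] AA' A'A DD.
have /choice[h hP] z : exists y, A' z -> A y /\ g y = z.
  have [/A'A[y Ay gy]|nA] := pselect (A' z); first by exists y.
  by exists z.
exists (map h s); split; first by rewrite size_map.
  by move=> _ /mapP[z /sA /hP[Az _] ->].
move=> x Ax; have [z zs xz] := sD _ (AA' _ Ax).
have [Ahz gz] := hP _ (sA _ zs).
by exists (h z); [exact: map_f|apply: DD; rewrite ?gz].
Qed.

(** A grid of cubes of side [r / (d + 1)]: each coordinate ranges over an interval of length
    [2 * a * r], which meets at most [2 * a * (d + 1) + 1] of its cells. *)
Lemma grid_labels (B : set V) a r : 0 <= a -> 0 < r ->
  (forall x y, B x -> B y -> enorm (x - y) <= a * r) ->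
  exists (T : finType) (lab : V -> T),
    #|T|%:R <= ((2 * d + 3)%:R * Num.max 1 a) ^+ d /\
    forall x y, B x -> B y -> lab x = lab y -> enorm (x - y) <= r.
Proof.
move=> a0 r0 diamB.
have [[x0 Bx0]|no] := pselect (exists x, B x); last first.
  exists unit, (fun=> tt); split=> [|x y Bx]; last by exfalso; apply: no; exists x.
  rewrite card_unit exprn_ege1 // -[leLHS]mulr1 ler_pM //.
    by rewrite ler1n addn_gt0 orbT.
  by rewrite le_max lexx.
pose n := Num.truncn (2 * a * d.+1%:R).
pose t (x : V) (i : 'I_d) : R := (x i 0 - x0 i 0 + a * r) * (d.+1%:R / r).
have rD : 0 < d.+1%:R / r by rewrite divr_gt0.
have t_ge0 x i : B x -> 0 <= t x i <= 2 * a * d.+1%:R.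
  move=> Bx; have := le_trans (norm_coord_enorm (x - x0) i) (diamB _ _ Bx Bx0).
  rewrite !mxE ler_norml => /andP[h1 h2]; rewrite /t.
  rewrite mulr_ge0 ?(ltW rD) //=; last by lra.
  have -> : 2 * a * d.+1%:R = (a * r + a * r) * (d.+1%:R / r).
    by rewrite -mulrDl mulrACA [_ * r^-1]mulrC; field; rewrite gt_eqF.
  by rewrite ler_wpM2r ?(ltW rD) // lerD2r.
exists {ffun 'I_d -> 'I_n.+1}, (fun x => [ffun i => inord (Num.truncn (t x i))]).
split=> [|x y Bx By /ffunP lab].
  rewrite card_ffun !card_ord natrX lerXn2r ?nnegrE ?mulr_ge0 //.
    by rewrite le_max ler01.
  have h : n.+1%:R <= 2 * a * d.+1%:R + 1.
    by rewrite -natr1 lerD2r truncn_le !mulr_ge0.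
  apply: le_trans h _; have m1 : 1 <= Num.max 1 a by rewrite le_max lexx.
  have ma : a <= Num.max 1 a by rewrite le_max lexx orbT.
  have d0 : 0 <= d%:R :> R := ler0n _ d.
  rewrite -natr1 natrD natrM; nra.
rewrite -[r](mulfVK (_ : d.+1%:R != 0)) // mulrC.
apply: enorm_le_coord => [|i]; first by rewrite divr_ge0 // ltW.
have /andP[tx tx'] := t_ge0 x i Bx; have /andP[ty ty'] := t_ge0 y i By.
have le_n s : 0 <= s -> s <= 2 * a * d.+1%:R -> (Num.truncn s <= n)%N.
  by move=> s0 sn; apply: le_truncn.
have := lab i; rewrite !ffunE => /(congr1 (@nat_of_ord _)).
rewrite !inordK ?ltnS ?le_n // => txy.
have /andP[x1 x2] := truncn_itv tx; have /andP[y1 y2] := truncn_itv ty.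
have : `|t x i - t y i| <= 1.
  rewrite txy -natr1 in x1 x2 *; rewrite -natr1 in y2; rewrite ler_norml; lra.
have -> : t x i - t y i = (x - y) i 0 * (d.+1%:R / r).
  by rewrite /t !mxE; ring.
by rewrite normrM (gtr0_norm rD) -ler_pdivlMr // div1r invf_div.
Qed.

End Cover.

(** * Growth of covers over blocks of iterates *)

Section Expansion.
Context {R : realType} {d : nat} {I : finType}.
Local Notation V := 'cV[R]_d.
Context (H : I -> seq (V * R)) (c : I -> R) (Q : I -> 'M[R]_d) (b : I -> V).
Context (c_gt0 : forall i, 0 < c i) (Q_orth : forall i, orthogonal_mx (Q i)).
Context (L : R) (L_ge1 : 1 <= L) (c_leL : forall i, c i <= L).
Implicit Types (w : seq I) (x y : V) (A : set V) (r : R).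

Local Notation cyl := (cylinder H c Q b).
Local Notation orbit_end := (orbit_end c Q b).
Local Notation dilation := (dilation c).

Definition domain n x := exists2 w, size w = n & cyl w x.

(** The common word makes both orbits follow the same affine maps, so that their distances scale by
    [dilation]. *)
Definition close n r x y := exists w, [/\ size w = n, cyl w x, cyl w y &
  forall k, (k < n)%N -> enorm (orbit_end (take k w) x - orbit_end (take k w) y) <= r].

Lemma enorm_orbit_endB w x y :
  enorm (orbit_end w x - orbit_end w y) = dilation w * enorm (x - y).
Proof.
rewrite orbit_endB // enormZ (gtr0_norm (dilation_gt0 _ _)) //.
by rewrite enorm_orthogonal //; exact: rotation_orthogonal.
Qed.

Lemma enorm_orbit_endB_le w m r x y : (size w <= m)%N -> enorm (x - y) <= r ->
  enorm (orbit_end w x - orbit_end w y) <= r * L ^+ m.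
Proof.
move=> wm xyr; rewrite enorm_orbit_endB mulrC.
apply: ler_pM => //; first exact: enorm_ge0.
  exact/ltW/dilation_gt0.
apply: (@le_trans _ _ (L ^+ size w)); last by rewrite ler_weXn2l.
elim: w {wm} => [|i w IH]; first by rewrite /dilation big_nil.
rewrite /dilation big_cons exprS ler_pM ?(ltW (c_gt0 i)) //.
exact/ltW/dilation_gt0.
Qed.

Definition small r A := forall x y, A x -> A y -> enorm (x - y) <= r.

Context (m j : nat) (r M E W : R).
Context (jm : (j <= m)%N) (r_gt0 : 0 < r).
Context (M_ge0 : 0 <= M) (E_ge0 : 0 <= E) (W_ge0 : 0 <= W).
Context (few_words : few (fun w => size w = j) W).
Context (few_cylinders : forall A, small r A ->
  few (fun u => size u = m /\ exists2 x, A x & cyl u x) M).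
Context (expansion_le : forall u x, size u = m -> cyl u x ->
  Num.max 1 (dilation u) ^+ d <= E).

(** The growth factor per block: [M] cylinders, each with an image cut into at most
    [(2 * d + 3) ^ d * E] pieces. *)
Let G := M * ((2 * d + 3)%:R ^+ d * E).

Let cover_start A : small r A ->
  has_cover (fun x => A x /\ domain j x) (close j (r * L ^+ m)) W.
Proof.
move=> sA; rewrite -[W]mulr1.
apply: (has_cover_bind (P := fun w => size w = j) (B := fun w x => A x /\ cyl w x)) => //.
- move=> w wj; apply: has_cover1 => x y [Ax wx] [Ay wy].
  exists w; split=> // k kj; apply: enorm_orbit_endB_le; last exact: sA.
  by rewrite size_takel ?wj ?(leq_trans _ jm) // ltnW.
- by move=> x [Ax [w wj wx]]; exists w.
- by move=> w x wj [Ax wx]; split=> //; exists w.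
Qed.

Lemma close_cat u n x y : size u = m -> cyl u x -> cyl u y ->
  enorm (x - y) <= r -> close n (r * L ^+ m) (orbit_end u x) (orbit_end u y) ->
  close (m + n) (r * L ^+ m) x y.
Proof.
move=> um ux uy xyr [w [wn wx wy wP]]; exists (u ++ w); split.
- by rewrite size_cat um wn.
- by rewrite cylinder_cat; split.
- by rewrite cylinder_cat; split.
- move=> k kn; rewrite take_cat um; case: ltnP => km.
    by apply: enorm_orbit_endB_le => //; rewrite size_takel ?um ltnW.
  by rewrite !orbit_end_cat; apply: wP; rewrite ltn_subLR.
Qed.

(** Cut [A] along the [m]-cylinders, map each part forward by [m] steps, cut the image by a grid
    into sets of diameter [r], and pull back the covers given by induction. Every block restarts at
    distance at most [r], so the radius [r * L ^+ m] does not depend on [l]. *)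
Theorem cover_growth l A : small r A ->
  has_cover (fun x => A x /\ domain (l * m + j) x)
        (close (l * m + j) (r * L ^+ m)) (W * G ^+ l).
Proof.
elim: l A => [|l IH] A sA; first by rewrite expr0 mulr1; exact: cover_start.
have G0 : 0 <= W * G ^+ l by rewrite mulr_ge0 // exprn_ge0 // !mulr_ge0.
have -> : W * G ^+ l.+1 = M * (((2 * d + 3)%:R ^+ d * E) * (W * G ^+ l)).
  by rewrite exprS {1}/G; ring.
rewrite mulSn -addnA; set n := (l * m + j)%N in IH *.
apply: (has_cover_bind (P := fun u => size u = m /\ exists2 x, A x & cyl u x)
  (B := fun u x => [/\ A x, cyl u x & domain n (orbit_end u x)])).
- by rewrite mulr_ge0 // mulr_ge0 // exprn_ge0.
- exact: few_cylinders.
- move=> u [um [x0 Ax0 ux0]].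
  pose B : set V := [set orbit_end u x | x in A `&` cyl u].
  have [||T [lab [Tcard labP]]] := @grid_labels _ _ B (dilation u) r _ r_gt0.
    exact/ltW/dilation_gt0.
    move=> _ _ [x [Ax ux] <-] [y [Ay uy] <-].
    rewrite enorm_orbit_endB ler_wpM2l ?sA //; exact/ltW/dilation_gt0.
  apply: (@has_cover_le _ _ _ _ (#|T|%:R * (W * G ^+ l))).
    rewrite ler_wpM2r //; apply: le_trans Tcard _.
    rewrite exprMn ler_wpM2l ?exprn_ge0 //; exact: expansion_le ux0.
  apply: (has_cover_bind (P := fun _ : T => True)
    (B := fun t x => [/\ A x, cyl u x, domain n (orbit_end u x) &
                          lab (orbit_end u x) = t])) => //.
  + by exists (enum T); rewrite ?cardE // => t _; rewrite mem_enum.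
  + move=> t _; have sB : small r [set z | B z /\ lab z = t].
      by move=> z z' [Bz zt] [Bz' z't]; apply: labP => //; rewrite zt.
    apply: (has_cover_pull (g := orbit_end u) (IH _ sB)).
    * by move=> x [Ax ux dx lx]; do !split=> //; exists x.
    * by move=> z [[[x [Ax ux] <-] lx] dx]; exists x.
    * by move=> x y [Ax ux _ _] [Ay uy _ _]; apply: close_cat => //; exact: sA.
  + by move=> x [Ax ux dx]; exists (lab (orbit_end u x)).
  + by move=> t x _ [].
- move=> x [Ax [w wn wx]].
  rewrite -(cat_take_drop m w) cylinder_cat in wx; case: wx => ux wx.
  have um : size (take m w) = m by rewrite size_takel // wn leq_addr.
  exists (take m w); first by split=> //; exists x.
  by split=> //; exists (drop m w); rewrite // size_drop wn addKn.
- move=> u x [um _] [Ax ux [w wn wx]]; split=> //.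
  by exists (u ++ w); rewrite ?size_cat ?um ?wn // cylinder_cat.
Qed.

End Expansion.

(** * Expansion rate and itineraries *)

Section ExteriorPower.
Context {R : realType}.

Lemma opnorm_ge_entry m n (A : 'M[R]_(m, n)) i j : `|A i j| <= opnorm A.
Proof.
pose B := \sum_i \sum_j `|A i j|.
have B0 : 0 <= B by apply: sumr_ge0 => ? _; exact: sumr_ge0.
apply: (@le_trans _ _ (enorm (A *m delta_mx j 0))).
  apply: le_trans (norm_coord_enorm (A *m delta_mx j 0) i).
  by rewrite -colE mxE.
apply: ub_le_sup; last first.
  exists (delta_mx j 0) => //=; rewrite enormE dotE (bigD1 j) //= big1 => [|k kj].
    by rewrite mxE !eqxx mulr1 addr0 sqrtr1.
  by rewrite mxE (negbTE kj) mulr0.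
(* The supremum dominates its elements only if the set is bounded; the sum of all entries gives a
   crude bound. *)
exists (m.+1%:R * B) => _ [x /= x1 <-]; apply: enorm_le_coord => // k.
rewrite mxE (le_trans (ler_norm_sum _ _ _)) //.
rewrite /B (bigD1 k) //= -[leLHS]addr0 lerD //; last first.
  by apply: sumr_ge0 => ? _; exact: sumr_ge0.
apply: ler_sum => l _; rewrite normrM ler_piMr //.
exact: le_trans (norm_coord_enorm _ _) x1.
Qed.

(** The entry at the empty index is an empty determinant, equal to 1. *)
Lemma opnorm_ext_pow0 d (A : 'M[R]_d) : 1 <= opnorm (ext_pow 0 A).
Proof.
have I0 : [ffun i : 'I_0 => widen_ord (leq0n d) i] \in @incr_index 0 d.
  by apply/forallP => -[].
pose k := enum_rank_in I0 [ffun i : 'I_0 => widen_ord (leq0n d) i].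
apply: le_trans (opnorm_ge_entry (ext_pow 0 A) k k).
by rewrite mxE det_mx00 normr1.
Qed.

(** The entry at the identity index is the full determinant, of absolute value [c ^+ d]. *)
Lemma opnorm_ext_pow_top d c (Q : 'M[R]_d) : 0 < c -> orthogonal_mx Q ->
  c ^+ d <= opnorm (ext_pow d (c *: Q)).
Proof.
move=> c0 oQ; have I0 : [ffun i : 'I_d => i] \in @incr_index d d.
  by apply/forallP => i; apply/forallP => j; rewrite !ffunE implybb.
pose k := enum_rank_in I0 [ffun i : 'I_d => i].
apply: le_trans (opnorm_ge_entry (ext_pow d (c *: Q)) k k).
rewrite mxE enum_rankK_in //.
have -> : mxsub [ffun i : 'I_d => i] [ffun i : 'I_d => i] (c *: Q) = c *: Q.
  by apply/matrixP => i j; rewrite mxE !ffunE.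
by rewrite detZ normrM norm_det_orthogonal // mulr1 ger0_norm // exprn_ge0 // ltW.
Qed.

(** The number [max(1, c) ^ d] is either 1 or [c ^ d], and these are bounded by the exterior powers
    of degrees 0 and [d]. *)
Lemma ln_le_ext_pow d c (Q : 'M[R]_d) : 0 < c -> orthogonal_mx Q ->
  ((ln (Num.max 1 c ^+ d))%:E <=
   \big[maxe/-oo]_(k < d.+1) lne (opnorm (ext_pow k (c *: Q)))%:E)%E.
Proof.
move=> c0 oQ.
have le_big (k : 'I_d.+1) z : 0 < z -> z <= opnorm (ext_pow k (c *: Q)) ->
    ((ln z)%:E <=
     \big[maxe/-oo]_(k < d.+1) lne (opnorm (ext_pow k (c *: Q)))%:E)%E.
  move=> z0 zk; apply: (@le_trans _ _ (lne (opnorm (ext_pow k (c *: Q)))%:E)).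
    by rewrite lne_EFin ?(lt_le_trans z0) // lee_fin ler_ln ?posrE // (lt_le_trans z0).
  exact: (le_bigmax _ (fun k : 'I_d.+1 => lne (opnorm (ext_pow k (c *: Q)))%:E)).
have [c1|c1] := leP 1 c.
  by apply: (le_big ord_max); rewrite ?exprn_gt0 // opnorm_ext_pow_top.
by rewrite expr1n; apply: (le_big ord0) => //; exact: opnorm_ext_pow0.
Qed.

End ExteriorPower.

(** * Coding of conformal piecewise affine maps by words *)

Section Coding.
Context {R : realType} {d : nat}.
Local Notation V := 'cV[R]_d.
Implicit Types (X Z : set V) (Zs : set (set V)) (f : V -> V) (x y : V).

Lemma open_polytope_polyhedron Z : open_polytope Z ->
  exists hs : seq (V * R), Z = polyhedron hs.
Proof.
move=> [_ [m [a [b ->]]]]; exists [seq ((a i)^T, b i) | i <- enum 'I_m].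
apply/seteqP; split=> x hx.
  by move=> _ /mapP[i _ ->]; rewrite /dot /= trmxK; exact: hx.
move=> i; have := hx ((a i)^T, b i); rewrite /dot /= trmxK; apply.
by apply/mapP; exists i; rewrite ?mem_enum.
Qed.

(** The sign of the scalar moves into the orthogonal factor. *)
Lemma conformal_mx_pos (A : 'M[R]_d) : conformal_mx A ->
  exists c Q, [/\ 0 < c, orthogonal_mx Q & A = c *: Q].
Proof.
move=> [c [Q [c0 QQ ->]]]; exists `|c|, (Num.sg c *: Q); split.
- by rewrite normr_gt0.
- have -> : orthogonal_mx (Num.sg c *: Q) =
      ((Num.sg c *: Q^T) *m (Num.sg c *: Q) = 1%:M).
    by congr (_ *m _ = _); apply/matrixP => i j; rewrite !mxE.
  rewrite -scalemxAl -scalemxAr scalerA QQ.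
  by rewrite -expr2 sqr_sg c0 scale1r.
- by rewrite scalerA mulrC -numEsg.
Qed.

Lemma paff_coding X Zs f : PAff X Zs f -> conformal Zs f ->
  exists (I : finType) (H : I -> seq (V * R)) (c : I -> R) (Q : I -> 'M[R]_d)
      (b : I -> V),
    [/\ forall i, 0 < c i, forall i, orthogonal_mx (Q i),
        forall i j x, polyhedron (H i) x -> polyhedron (H j) x -> i = j,
        forall x, regular_set Zs x <-> exists i, polyhedron (H i) x &
        forall i x, polyhedron (H i) x ->
          f x = step c Q b i x /\ paff_diff Zs f x = c i *: Q i].
Proof.
move=> pf cf; have /finite_seqP[s sE] := PAff_finite pf.
(* Only nonempty cells become letters, as conformality says nothing about the linear part on an
   empty one. *)
pose I : finType := seq_sub [seq Z <- s | `[< Z !=set0 >]].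
have valP (i : I) : Zs (ssval i) /\ ssval i !=set0.
  by have := ssvalP i; rewrite mem_filter => /andP[/asboolP ? ?]; rewrite sE.
have /choice[F FP] (i : I) : exists F : seq (V * R) * R * 'M[R]_d * V,
    [/\ ssval i = polyhedron F.1.1.1, 0 < F.1.1.2, orthogonal_mx F.1.2,
      linear_part f (ssval i) = F.1.1.2 *: F.1.2 &
      forall x, ssval i x -> f x = linear_part f (ssval i) *m x + F.2].
  have [Zi Zi0] := valP i.
  have [hs hsE] := open_polytope_polyhedron (PAff_polytope pf Zi).
  have [c [Q [c0 oQ AE]]] := conformal_mx_pos (cf _ Zi Zi0).
  have [b bE] : affine_on (ssval i) f (linear_part f (ssval i)).
    by have [A AP] := PAff_affine pf Zi; exact: (xgetI 0 AP).
  by exists (hs, c, Q, b).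
have cellE i x : polyhedron (F i).1.1.1 x <-> ssval i x by have [->] := FP i.
exists I, (fun i => (F i).1.1.1), (fun i => (F i).1.1.2), (fun i => (F i).1.2),
  (fun i => (F i).2); split.
- by move=> i; have [] := FP i.
- by move=> i; have [] := FP i.
- move=> i j x /cellE ix /cellE jx; apply/val_inj/(PAff_disjoint pf).
  + exact: (valP i).1.
  + exact: (valP j).1.
  + by exists x.
- move=> x; split=> [[Z ZZ Zx]|[i /cellE ix]]; last first.
    by exists (ssval i) => //; exact: (valP i).1.
  have Zs' : Z \in [seq Z <- s | `[< Z !=set0 >]].
    rewrite mem_filter; apply/andP; split; first by apply/asboolP; exists x.
    by move: ZZ; rewrite sE.
  by exists (SeqSub Zs'); apply/cellE.
- move=> i x /cellE ix; have [_ _ _ AE fE] := FP i.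
  split; first by rewrite fE // AE /step -scalemxAl.
  rewrite -AE /paff_diff; congr (linear_part f _).
  case: xgetP => [Z -> [ZZ Zx]|/(_ (ssval i))]; last first.
    by case; split=> //; exact: (valP i).1.
  apply: (PAff_disjoint pf) => //; first exact: (valP i).1.
  by exists x.
Qed.

Context (Zs : set (set V)) (f : V -> V) (I : finType) (H : I -> seq (V * R))
  (c : I -> R) (Q : I -> 'M[R]_d) (b : I -> V).
Context (regularE : forall x, regular_set Zs x <-> exists i, polyhedron (H i) x).
Context (branchE : forall i x, polyhedron (H i) x ->
  f x = step c Q b i x /\ paff_diff Zs f x = c i *: Q i).
Implicit Types (w : seq I).

Lemma iter_cylinder w x k : cylinder H c Q b w x -> (k <= size w)%N ->
  iter k f x = orbit_end c Q b (take k w) x.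
Proof.
elim: w x k => [|i w IH] x [|k] //= [ix wx] kw.
by rewrite -iterS iterSr (branchE ix).1 IH.
Qed.

Lemma iter_domP n x : iter_dom Zs f n x <-> domain H c Q b n x.
Proof.
split; last first.
  move=> [w wn wx] k kn; apply/regularE; rewrite (iter_cylinder wx) ?wn 1?ltnW //.
  move: wx; rewrite -[w in cylinder _ _ _ _ w](cat_take_drop k) cylinder_cat => -[_].
  have : size (drop k w) != 0 by rewrite size_drop wn -lt0n subn_gt0.
  by case: (drop k w) => [|i u] //= _ [? _]; exists i.
elim: n x => [|n IH] x dx; first by exists [::].
have [i ix] : exists i, polyhedron (H i) x by apply/regularE; exact: (dx 0).
have [|w wn wx] := IH (step c Q b i x).
  by move=> k kn; rewrite -(branchE ix).1 -iterSr; exact: dx.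
by exists (i :: w); rewrite /= ?wn.
Qed.

Lemma paff_diffn_cylinder w x : cylinder H c Q b w x ->
  paff_diffn Zs f (size w) x = dilation c w *: rotation Q w.
Proof.
elim/last_ind: w => [|w i IH]; first by rewrite /dilation big_nil scale1r.
rewrite -cats1 cylinder_cat cats1 => -[wx [ix _]].
rewrite size_rcons /= (IH wx) (iter_cylinder wx) // take_size (branchE ix).2.
rewrite /dilation -cats1 big_cat big_seq1 /= cats1 rotation_rcons.
by rewrite -scalemxAl -scalemxAr scalerA mulrC.
Qed.

End Coding.

(** * The entropy bound *)

Section UpperLimit.
Context {R : realType}.
Implicit Types (u v : (\bar R)^nat) (a : \bar R).
Local Open Scope ereal_scope.

Lemma limn_esup_le u a N : (forall n, (N <= n)%N -> u n <= a) -> limn_esup u <= a.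
Proof.
move=> ua; apply: le_trans (_ : ereal_sup (u @` [set n | (N <= n)%N]) <= _).
  by apply: ereal_inf_lbound; exists [set n | (N <= n)%N] => //; exists N.
by apply: ge_ereal_sup => _ [n /ua ? <-].
Qed.

Lemma limn_esup_lt u a : limn_esup u < a ->
  exists N, forall n, (N <= n)%N -> u n < a.
Proof.
move=> /ereal_inf_lt[_ [A [N _ NA] <-] supa]; exists N => n Nn.
apply: le_lt_trans supa; apply: ereal_sup_ubound.
by exists n => //; exact: NA.
Qed.

Lemma limn_esup_ge u a N : (forall n, (N <= n)%N -> a <= u n) -> a <= limn_esup u.
Proof.
move=> ua; apply: le_ereal_inf_tmp => _ [A [M _ MA] <-].
apply: le_trans (ua (maxn N M) (leq_maxl _ _)) _; apply: ereal_sup_ubound.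
by exists (maxn N M) => //; apply: MA; exact: leq_maxr.
Qed.

Lemma limn_esup_mono u v : (forall n, u n <= v n) -> limn_esup u <= limn_esup v.
Proof.
move=> uv; apply: le_ereal_inf_tmp => _ [A FA <-].
apply: (@le_trans _ _ (ereal_sup (u @` A))).
  by apply: ereal_inf_lbound; exists A.
apply: ge_ereal_sup => _ [n An <-]; apply: le_trans (uv n) _.
by apply: ereal_sup_ubound; exists n.
Qed.

End UpperLimit.

Section Entropy.
Context {R : realType} {d : nat}.
Local Notation V := 'cV[R]_d.
Implicit Types (X : set V) (rho : V -> V -> R) (eps : R).

Section Metric.
Context (Zs : set (set V)) (f : V -> V) (rho : V -> V -> R).

Lemma cover_num_ge0 n eps : (0 <= cover_num Zs f rho n eps)%E.
Proof. by apply: le_ereal_inf_tmp => _ [s _ <-]; rewrite lee_fin. Qed.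

Lemma cover_num_le (n : nat) eps (N : R) :
  has_cover (iter_dom Zs f n) (fun x y => dyn_dist rho f n y x < eps) N ->
  (cover_num Zs f rho n eps <= N%:E)%E.
Proof.
move=> [s [sN sA sD]]; apply: (@le_trans _ _ (size s)%:R%:E); last by rewrite lee_fin.
by apply: ereal_inf_lbound; exists s.
Qed.

Lemma cover_num_nonincreasing n eps eps' : eps <= eps' ->
  (cover_num Zs f rho n eps' <= cover_num Zs f rho n eps)%E.
Proof.
move=> ee; apply: le_ereal_inf_tmp => _ [s [sA sD] <-].
apply: ereal_inf_lbound; exists s => //; split=> // x /sD[y ys xy].
by exists y => //; exact: lt_le_trans xy ee.
Qed.

(** Covering numbers grow as [eps] decreases, so the limit defining the entropy exists and inherits
    the bound. *)
Lemma htop_le (a : \bar R) :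
  (forall eps, 0 < eps ->
    (limn_esup (fun n => (n%:R^-1)%:E * lne (cover_num Zs f rho n eps)) <= a)%E) ->
  (htop Zs f rho <= a)%E.
Proof.
move=> ha; apply: lime_le; last first.
  near=> eps; apply: ha; near: eps; exact: nbhs_right_gt.
apply: nonincreasing_at_right_is_cvge; near=> z => x y _ _ xy.
apply: limn_esup_mono => n.
apply: lee_wpmul2l; first by rewrite lee_fin invr_ge0.
rewrite lee_lne; first exact: cover_num_nonincreasing.
  by rewrite in_itv /= leey cover_num_ge0.
by rewrite in_itv /= leey cover_num_ge0.
Unshelve. all: by end_near. Qed.

End Metric.

(** * Entropy of a coded map *)

Section Coded.
Context (X : set V) (Zs : set (set V)) (f : V -> V) (rho : V -> V -> R)
  (I : finType) (H : I -> seq (V * R)) (c : I -> R) (Q : I -> 'M[R]_d) (b : I -> V).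
Context (cX : compact X) (mX : std_metric X rho).
Context (XE : regular_set Zs `<=` X).
Context (c_gt0 : forall i, 0 < c i) (Q_orth : forall i, orthogonal_mx (Q i)).
Context (disj : forall i j x, polyhedron (H i) x -> polyhedron (H j) x -> i = j).
Context (regularE : forall x, regular_set Zs x <-> exists i, polyhedron (H i) x).
Context (branchE : forall i x, polyhedron (H i) x ->
  f x = step c Q b i x /\ paff_diff Zs f x = c i *: Q i).

Local Notation cyl := (cylinder H c Q b).

Let rate n : \bar R := ereal_sup
    [set ((n%:R^-1)%:E *
          \big[maxe/-oo]_(k < d.+1)
            lne (opnorm (ext_pow k (paff_diffn Zs f n x)))%:E)%E
    | x in iter_dom Zs f n].

(** Here the exterior powers enter: the rate controls [max(1, c) ^ d], the factor by which the grid
    multiplies the pieces. *)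
Let cylinder_rate w x : cyl w x ->
  (((size w)%:R^-1 * ln (Num.max 1 (dilation c w) ^+ d))%:E <= rate (size w))%E.
Proof.
move=> wx; apply: (@le_trans _ _ (((size w)%:R^-1)%:E *
    \big[maxe/-oo]_(k < d.+1)
       lne (opnorm (ext_pow k (paff_diffn Zs f (size w) x)))%:E)%E).
  rewrite EFinM lee_wpmul2l ?lee_fin ?invr_ge0 //.
  rewrite (paff_diffn_cylinder branchE wx); apply: ln_le_ext_pow.
    exact: dilation_gt0.
  exact: rotation_orthogonal.
by apply: ereal_sup_ubound; exists x => //; apply/(iter_domP regularE branchE); exists w.
Qed.

Let rate_ge0 n x : iter_dom Zs f n x -> (0 <= rate n)%E.
Proof.
move=> /(iter_domP regularE branchE)[w <- /cylinder_rate]; apply: le_trans.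
rewrite lee_fin mulr_ge0 ?invr_ge0 // ln_ge0 // exprn_ege1 //.
by rewrite le_max lexx.
Qed.

(** By a Lebesgue number for the half-spaces of all [m]-cylinders, those meeting a small set have a
    common point [p] in their closures; by convexity their tangent cones at [p] are nonempty. *)
Let few_cylinders_small m (M : R) : (0 < m)%N -> 0 <= M ->
  (forall p, few (fun u => size u = m /\ tangent p (cyl u) !=set0) M) ->
  exists2 e, 0 < e & forall r A, r < e -> small r A ->
    few (fun u => size u = m /\ exists2 x, A x & cyl u x) M.
Proof.
move=> m0 M0 fM; have [hs hsP] := halfspaces_of_size H c Q b m.
have [e e0 eP] := lebesgue_halfspaces hs cX ltr01.
exists e => // r A re sA.
have [[u0 [u0m [q Aq u0q]]]|no] :=
  pselect (exists u, size u = m /\ exists2 x, A x & cyl u x); last first.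
  by exists [::] => // u uP; exfalso; apply: no; exists u.
have [|p [_ _ pP]] := eP q.
  (* As [0 < m], the word [u0] has a first letter, whose cell contains [q] and lies in [X]. *)
  apply: XE; apply/regularE; case: u0 u0m u0q => [|i u] /=.
    by move=> m0'; rewrite -m0' in m0.
  by move=> _ [? _]; exists i.
apply: few_sub (fM p) => u [um [x Ax ux]]; split=> //; exists (x - p).
rewrite cylinderE in ux *; apply: tangent_polyhedron_sub => // h hu.
apply: (pP h _ x); [exact: hsP hu|exact: le_lt_trans (sA _ _ Ax Aq) re|exact: ux].
Qed.

Let few_words_le m : exists2 W : R, 1 <= W & forall j, (j < m)%N ->
  few (fun w : seq I => size w = j) W.
Proof.
(* The successor keeps the base at least 1 even for an empty alphabet, so that powers increase with
   the exponent. *)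
exists (#|I|.+1%:R ^+ m) => [|j jm]; first by rewrite exprn_ege1 // ler1n.
exists [seq val t | t <- enum {: j.-tuple I}] => [|w wj]; last first.
  by subst j; apply/mapP; exists (in_tuple w); rewrite ?mem_enum.
rewrite size_map -cardE card_tuple -natrX ler_nat.
apply: (@leq_trans (#|I|.+1 ^ j)); first by case: j {jm} => // j; rewrite leq_exp2r.
by rewrite leq_pexp2l // ltnW.
Qed.

(** Of the three [delta], one is the slack in the rate, one pays for the multiplicity of cylinders
    and one for the grid constant [K0]. *)
Let cover_orbits (a delta eps : R) N0 : 0 <= a -> 0 < delta -> 0 < eps ->
  (forall n, (N0 <= n)%N -> (rate n < (a + delta)%:E)%E) ->
  exists2 C : R, 1 <= C & forall n, (0 < n)%N ->
    has_cover (iter_dom Zs f n) (fun x y => dyn_dist rho f n y x < eps)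
      (C * expR (n%:R * (a + 3 * delta))).
Proof.
move=> a0 d0 e0 rate_lt; set K0 : R := (2 * d + 3)%:R ^+ d.
(* The block length must reach the range of the rate bound, be positive, and satisfy
   [K0 <= exp (delta * m)]. *)
pose N1 := maxn (maxn N0 1) (Num.truncn (K0 / delta)).+1.
have [m] := multiplicity_subexp b c_gt0 Q_orth disj N1 d0.
rewrite /N1 !geq_max -andbA => /and3P[N0m m0 mK] fM.
have {}mK : K0 <= expR (delta * m%:R).
  apply: le_trans (expR_ge1Dx _).
  have : K0 / delta < m%:R.
    by apply: lt_le_trans (truncnS_gt _) _; rewrite ler_nat.
  by rewrite ltr_pdivrMr // mulrC; lra.
have [e e_gt0 eP] := few_cylinders_small m0 (expR_ge0 _) fM.
have [eta eta0 etaP] := std_metric_unif cX mX e0.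
pose L := 1 + \sum_i c i.
have L1 : 1 <= L by rewrite lerDl sumr_ge0 // => i _; exact: ltW.
have cL i : c i <= L.
  rewrite /L (bigD1 i) //= addrCA lerDl addr_ge0 // sumr_ge0 // => j _.
  exact: ltW.
have L0 : 0 < L ^+ m by rewrite exprn_gt0 // (lt_le_trans ltr01).
(* The first bound lets sets of diameter [r] meet few cylinders; the second keeps distances within a
   block below [eta], hence [rho] below [eps]. *)
pose r := Num.min (e / 2) (eta / 2 / L ^+ m).
have r0 : 0 < r by rewrite lt_min !divr_gt0.
have re : r < e.
  by rewrite /r gt_min; apply/orP; left; lra.
have rL : r * L ^+ m < eta.
  apply: (@le_lt_trans _ _ (eta / 2)); last by lra.
  by rewrite -ler_pdivlMr // ge_min lexx orbT.
have [W W1 fW] := few_words_le m.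
have W0 : 0 <= W := le_trans ler01 W1.
pose E := expR (m%:R * (a + delta)).
have expansion_le (u : seq I) x : size u = m -> cyl u x ->
    Num.max 1 (dilation c u) ^+ d <= E.
  move=> um ux; have := le_lt_trans (cylinder_rate ux) (rate_lt _ _).
  rewrite um => /(_ N0m); rewrite lte_fin ltr_pdivrMl ?ltr0n // => lt_m.
  have z0 : 0 < Num.max 1 (dilation c u) ^+ d.
    by rewrite exprn_gt0 // lt_max ltr01.
  by rewrite -[leLHS]lnK ?posrE // ler_expR ltW.
have r20 : 0 < r / 2 by rewrite divr_gt0.
have [net netP] := compact_net cX r20.
pose C := (size net)%:R * W + 1.
exists C => [|n n0]; first by rewrite lerDr mulr_ge0.
pose G := expR (delta * m%:R) * (K0 * E).
have GE : G <= expR (m%:R * (a + 3 * delta)).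
  have -> : m%:R * (a + 3 * delta) =
      delta * m%:R + (delta * m%:R + m%:R * (a + delta)) by ring.
  by rewrite 2!expRD ler_pM2l ?expR_gt0 // ler_pM2r ?expR_gt0.
have G0 : 0 <= G by rewrite !mulr_ge0 ?expR_ge0 // exprn_ge0.
pose q := (n %/ m)%N; pose j := (n %% m)%N.
have nE : n = (q * m + j)%N := divn_eq n m.
have jm : (j < m)%N by rewrite ltn_mod.
apply: (@has_cover_le _ _ _ _ ((size net)%:R * (W * G ^+ q))).
  rewrite mulrA; apply: ler_pM.
  - exact: mulr_ge0.
  - exact: exprn_ge0.
  - by rewrite lerDl.
  apply: le_trans (_ : expR (m%:R * (a + 3 * delta)) ^+ q <= _).
    by rewrite lerXn2r // nnegrE // expR_ge0.
  rewrite -expRM_natl ler_expR mulrA -natrM ler_wpM2r //.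
    by rewrite addr_ge0 // mulr_ge0 // ltW.
  by rewrite ler_nat [leqRHS]nE leq_addr.
apply: (has_cover_bind (P := fun g => g \in net)
  (B := fun g x => [set x | enorm (x - g) < r / 2] x /\ domain H c Q b (q * m + j) x)).
- by rewrite mulr_ge0 // exprn_ge0.
- by exists net.
- move=> g _.
  have sB : small r [set x | enorm (x - g) < r / 2].
    move=> x y /= xg yg; apply: le_trans (enorm_triangle g x y) _.
    by rewrite (enorm_distC g); lra.
  have cov := cover_growth c_gt0 Q_orth L1 cL (ltnW jm) r0 (expR_ge0 _) (expR_ge0 _)
    W0 (fW _ jm) (fun A => eP r A re) expansion_le q sB.
  apply: (has_cover_pull (g := id) cov) => // [z Bz|x y [_ dx] [_ dy]]; first by exists z.
  rewrite -nE in dx dy *.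
  move: dx dy => /(iter_domP regularE branchE) dx /(iter_domP regularE branchE) dy.
  move=> [w [wn wx wy xyP]]; apply/bigmax_ltP; split=> // k _.
  apply: etaP; [exact/XE/dy|exact/XE/dx|].
  rewrite !(iter_cylinder branchE (w := w)) ?wn 1?ltnW //.
  by rewrite enorm_distC; apply: le_lt_trans rL; exact: xyP.
- move=> x dx; have /XE/netP[g gs xg] : regular_set Zs x by exact: (dx 0).
  by exists g => //; split=> //; rewrite -nE; apply/(iter_domP regularE branchE).
- by move=> g x _ [_]; rewrite -nE => /(iter_domP regularE branchE).
Qed.

Let htop_le_empty N : (forall x, ~ iter_dom Zs f N x) ->
  (htop Zs f rho <= -oo)%E.
Proof.
(* The empty cover gives covering number 0 with logarithm [-oo]. Starting at [N.+1] excludes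
   [n = 0], where the factor [n^-1] is 0 and the product is not [-oo]. *)
move=> noN; apply: htop_le => eps e0; apply: (@limn_esup_le _ _ _ N.+1) => n Nn.
rewrite le0_lneNy; first by rewrite gt0_muleNy // lte_fin invr_gt0 ltr0n (leq_trans _ Nn).
apply: cover_num_le; exists [::]; split=> // x dx; exfalso; apply: (noN x) => k kN.
by apply: dx; rewrite (ltn_trans kN).
Qed.

Let htop_le_finite (a : R) : 0 <= a -> (limn_esup rate <= a%:E)%E ->
  (htop Zs f rho <= a%:E)%E.
Proof.
move=> a0 rate_le; apply: htop_le => eps e0; apply/lee_addgt0Pr => e' e'0.
(* Three quarters go to the exponent in the cover bound, one to [ln C / n]. *)
pose delta := e' / 4; have d0 : 0 < delta by rewrite divr_gt0.
have [N0 NP] : exists N, forall n, (N <= n)%N -> (rate n < (a + delta)%:E)%E.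
  by apply: limn_esup_lt; apply: le_lt_trans rate_le _; rewrite lte_fin ltrDl.
have [C C1 CP] := cover_orbits a0 d0 e0 NP.
apply: (@limn_esup_le _ _ _ (Num.truncn (ln C / delta)).+1) => n Nn.
have n0 : (0 < n)%N := leq_trans (ltn0Sn _) Nn.
have C0 : 0 < C := lt_le_trans ltr01 C1.
have := cover_num_le (CP n n0).
set z := (X in (X%:E)%E); have z0 : 0 < z by rewrite mulr_gt0 // expR_gt0.
move=> cov; apply: (@le_trans _ _ ((n%:R^-1)%:E * (ln z)%:E)%E).
  apply: lee_wpmul2l; first by rewrite lee_fin invr_ge0.
  rewrite -lne_EFin // lee_lne // in_itv /= leey andbT ?cover_num_ge0 //.
  by rewrite lee_fin ltW.
rewrite -EFinM -EFinD lee_fin ler_pdivrMl ?ltr0n // /z lnM ?posrE ?expR_gt0 // expRK.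
have : ln C <= n%:R * delta.
  rewrite -ler_pdivrMr // ltW //; apply: lt_le_trans (truncnS_gt _) _.
  by rewrite ler_nat.
have -> : e' = 4 * delta by rewrite /delta; field.
by rewrite !mulrDr; lra.
Qed.

Lemma htop_le_expansion_rate : (htop Zs f rho <= expansion_rate Zs f)%E.
Proof.
have [[N noN]|dom] := pselect (exists N, forall x, ~ iter_dom Zs f N x).
  exact: le_trans (htop_le_empty noN) (leNye _).
(* All domains are nonempty here, so each rate is nonnegative and the value [-oo] is excluded. *)
have rate0 : (0 <= limn_esup rate)%E.
  apply: (@limn_esup_ge _ _ _ 0) => n _.
  have [[x /rate_ge0 //]|no] := pselect (exists x, iter_dom Zs f n x).
  by exfalso; apply: dom; exists n => x dx; apply: no; exists x.
rewrite -[leRHS]/(limn_esup rate).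
case: (limn_esup rate) (@htop_le_finite) rate0 => [a fin|_ _|_] //.
  by rewrite lee_fin => a0; exact: fin.
exact: leey.
Qed.

End Coded.
End Entropy.

Theorem corollary1 (R : realType) (d : nat) (X : set 'cV[R]_d)
    (Zs : set (set 'cV[R]_d)) (f : 'cV[R]_d -> 'cV[R]_d)
    (rho : 'cV[R]_d -> 'cV[R]_d -> R)
    (hf : PAff X Zs f) (hconf : conformal Zs f) (hrho : std_metric X rho) :
  (htop Zs f rho <= expansion_rate Zs f)%E.
Proof.
have [I [H [c [Q [b [c_gt0 Q_orth disj regularE branchE]]]]]] :=
  paff_coding hf hconf.
exact: htop_le_expansion_rate (PAff_compact hf) hrho (PAff_sub hf) c_gt0 Q_orth
  disj regularE branchE.
Qed.
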